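(* Consider the problem, the Lagrangian $\mathcal L$ and the NPGA iteration described in the context. Assume: (1) $\mathcal{L}$ has at least one saddle point; (2) the network graph is undirected and connected; (3) for every $i$, $f_i$ is $\mu_i$-strongly convex and $l_i$-smooth with $l_i\ge\mu_i>0$, and $g_i$ and $h$ are proper, convex and lower semicontinuous; put $\mu=\min_i\mu_i$, $l=\max_i l_i$; (4) the symmetric matrices $B,C,D\in\mathbb{R}^{n\times n}$ satisfy: $C=0$ or $\mathrm{Null}(C)=\mathrm{Span}(\mathbf 1_n)$; $\mathrm{Null}(B)=\mathrm{Span}(\mathbf 1_n)$; $0\le C<I$ and $B^2\le I$; $D$ is symmetric doubly stochastic; (5) $g_i=0$ for all $i$ and $A=[A_1,\dots,A_n]$ has full row rank; (6) $h$ is the indicator function of a point: for some fixed $b\in\mathbb R^p$, $h(y)=0$ if $y=b$ and $h(y)=+\infty$ if $y\ne b$; (7) $D(I-C)D\le I-B^2$. Let $\mathbf y^0=0$, $\theta=0$, and let the positive step-sizes $\alpha,\beta,\gamma$ satisfy $$\alpha<\frac1l,\qquad \beta\le\frac{\mu(1-\overline\sigma(C))}{\overline\sigma^2(\mathbf A)},\qquad \gamma<1.$$ Let $F=\mathbf D\mathbf A\mathbf A^\top\mathbf D+\frac{1-\gamma}{\alpha\beta}\mathbf B^2$. Then $$\delta=\max\left\{1-\alpha\mu(1-\alpha l),\ 1-\alpha\beta\,\underline\eta(F),\ 1-\gamma\underline\sigma^2(B)\right\}$$ lies in $(0,1)$, and the NPGA iterates satisfy $\|\mathbf x^k-\mathbf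 x^*\|^2=\mathcal O(\delta^k)$.
   Context: Problem: $n$ agents solve $\min_{x_i\in\mathbb R^{d_i}}\sum_{i=1}^n (f_i(x_i)+g_i(x_i))+h\left(\sum_{i=1}^n A_ix_i\right)$, where $f_i:\mathbb R^{d_i}\to\mathbb R$, $g_i:\mathbb R^{d_i}\to\mathbb R\cup\{+\infty\}$, $h:\mathbb R^p\to\mathbb R\cup\{+\infty\}$, $A_i\in\mathbb R^{p\times d_i}$; the solution set is assumed nonempty. Let $d=\sum_i d_i$, $\mathbf x=[x_1^\top,\dots,x_n^\top]^\top\in\mathbb R^d$, $f(\mathbf x)=\sum_i f_i(x_i)$, $g(\mathbf x)=\sum_i g_i(x_i)$, $A=[A_1,\dots,A_n]\in\mathbb R^{p\times d}$, $\mathbf A=\mathrm{diag}(A_1,\dots,A_n)\in\mathbb R^{np\times d}$ (block diagonal). $h^*$ is the Fenchel conjugate of $h$. The Lagrangian is $\mathcal L(\mathbf x,\lambda)=f(\mathbf x)+g(\mathbf x)+\lambda^\top A\mathbf x-h^*(\lambda)$ for $\lambda\in\mathbb R^p$ (min over $\mathbf x$, max over $\lambda$). ''$l_i$-smooth'' means differentiable with $l_i$-Lipschitz gradient. Notation: for symmetric matrices, $M\le N$ ($M<N$) means $N-M$ is positive semidefinite (positive definite). $\overline\sigma(\cdot)$ and $\underline\sigma(\cdot)$ are the largest and the smallest non-zero singular values; $\underline\eta(\cdot)$ is the smallest non-zero eigenvalue. $\mathbf 1_n$ is the all-ones vector. $\mathrm{prox}_{\alpha \phi}(x)=\arg\min_y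 \phi(y)+\frac1{2\alpha}\|y-x\|^2$. The network is a graph on the agents $\{1,\dots,n\}$; $B,C,D\in\mathbb R^{n\times n}$ are symmetric matrices associated with it, $\mathbf B=B\otimes I_p$, $\mathbf C=C\otimes I_p$, $\mathbf D=D\otimes I_p$. For $\boldsymbol\lambda=[\lambda_1^\top,\dots,\lambda_n^\top]^\top\in\mathbb R^{np}$ put $\mathbf h(\boldsymbol\lambda)=\frac1n\sum_{i=1}^n h^*(\lambda_i)$. NPGA: given parameters $\alpha,\beta,\gamma>0$, $\theta\ge0$ and initial points $\mathbf x^0\in\mathbb R^d$, $\boldsymbol\lambda^0\in\mathbb R^{np}$ (arbitrary) and $\mathbf y^0\in\mathbb R^{np}$, for $k\ge0$: $\mathbf x^{k+1}=\mathrm{prox}_{\alpha g}(\mathbf x^k-\alpha(\nabla f(\mathbf x^k)+\mathbf A^\top\boldsymbol\lambda^k))$, $\hat{\mathbf x}^{k+1}=\mathbf x^{k+1}+\theta(\mathbf x^{k+1}-\mathbf x^k)$, $\mathbf v^{k+1}=\boldsymbol\lambda^k-\mathbf C\boldsymbol\lambda^k-\mathbf B\mathbf y^k+\beta\mathbf A\hat{\mathbf x}^{k+1}$, $\mathbf y^{k+1}=\mathbf y^k+\gamma\mathbf B\mathbf v^{k+1}$, $\boldsymbol\lambda^{k+1}=\mathrm{prox}_{\beta\mathbf h}(\mathbf D\mathbf v^{k+1})$. $\mathbf x^*$ denotes the (unique) solution of the problem, i.e. the $\mathbf x$-component of the saddle point of $\mathcal L$. *)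

(* Defs.v *)
From HB Require Import structures.
From mathcomp Require Import all_boot all_order all_algebra.
From mathcomp Require Import all_classical all_reals all_analysis.

Set Implicit Arguments.
Unset Strict Implicit.
Unset Printing Implicit Defensive.

Import Order.TTheory GRing.Theory Num.Theory.
Import numFieldNormedType.Exports.

Local Open Scope classical_set_scope.
Local Open Scope ring_scope.

(** * Euclidean structure and smooth functions *)

Definition dotp (R : realType) (m : nat) (u v : 'cV[R]_m) : R :=
  (u^T *m v) 0 0.

(* The norm [`|x|] of the library on matrices is the sup norm. *)
Definition enorm (R : realType) (m : nat) (u : 'cV[R]_m) : R :=
  Num.sqrt (dotp u u).

Definition grad (R : realType) (m : nat) (f : 'cV[R]_m -> R) (x : 'cV[R]_m) :
    'cV[R]_m :=
  \col_i 'd f x (delta_mx i 0).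

Definition smooth (R : realType) (m : nat) (l : R) (f : 'cV[R]_m -> R) : Prop :=
  (forall x, differentiable f x) /\
  (forall x y, enorm (grad f x - grad f y) <= l * enorm (x - y)).

Definition strongly_convex (R : realType) (m : nat) (mu : R)
    (f : 'cV[R]_m -> R) : Prop :=
  forall (x y : 'cV[R]_m) (t : R), 0 <= t <= 1 ->
    f (t *: x + (1 - t) *: y) <=
      t * f x + (1 - t) * f y - mu / 2 * t * (1 - t) * enorm (x - y) ^+ 2.

(** * Extended-valued functions *)

Definition proper (R : realType) (T : Type) (phi : T -> \bar R) : Prop :=
  (forall x, phi x != -oo%E) /\ (exists x, phi x \is a fin_num).

(* Used for functions that never take the value -oo, so the right-hand side
   is not of the form +oo - oo; recall that 0 * +oo = 0. *)
Definition econvex (R : realType) (m : nat) (phi : 'cV[R]_m -> \bar R) : Prop :=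
  forall (x y : 'cV[R]_m) (t : R), 0 <= t <= 1 ->
    (phi (t *: x + (1 - t) *: y)%R <= t%:E * phi x + (1 - t)%:E * phi y)%E.

Definition proper_convex_lsc (R : realType) (m : nat)
    (phi : 'cV[R]_m -> \bar R) : Prop :=
  [/\ proper phi, econvex phi & lower_semicontinuous phi].

Definition fenchel (R : realType) (m : nat) (phi : 'cV[R]_m -> \bar R)
    (la : 'cV[R]_m) : \bar R :=
  ereal_sup [set ((dotp la y)%:E - phi y)%E | y in setT].

Definition argmin (R : realType) (T : Type) (phi : T -> \bar R) : set T :=
  [set z | forall y, (phi z <= phi y)%E].

(* The minimiser is unique when phi is proper, convex and lower semicontinuous
   and a > 0; the default value 0 is only used when there is no minimiser. *)
Definition prox (R : realType) (m : nat) (a : R) (phi : 'cV[R]_m -> \bar R)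
    (x : 'cV[R]_m) : 'cV[R]_m :=
  xget 0 (argmin (fun y => phi y + ((2 * a)^-1 * enorm (y - x) ^+ 2)%:E)%E).

(** * Matrices *)

Definition psdmx (R : realType) (m : nat) (M : 'M[R]_m) : Prop :=
  M^T = M /\ forall z : 'cV[R]_m, 0 <= dotp z (M *m z).

Definition pdmx (R : realType) (m : nat) (M : 'M[R]_m) : Prop :=
  M^T = M /\ forall z : 'cV[R]_m, z != 0 -> 0 < dotp z (M *m z).

Definition mxle (R : realType) (m : nat) (M N : 'M[R]_m) : Prop :=
  psdmx (N - M).

Definition mxlt (R : realType) (m : nat) (M N : 'M[R]_m) : Prop :=
  pdmx (N - M).

Definition null_span1 (R : realType) (m : nat) (M : 'M[R]_m) : Prop :=
  forall z : 'cV[R]_m, M *m z = 0 <-> exists c : R, z = c *: const_mx 1.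

Definition doubly_stochastic (R : realType) (m : nat) (M : 'M[R]_m) : Prop :=
  [/\ forall i j, 0 <= M i j,
      forall i, \sum_j M i j = 1
    & forall j, \sum_i M i j = 1].

Definition singular_values (R : realType) (m q : nat) (M : 'M[R]_(m, q)) :
    set R :=
  [set s | 0 <= s /\ eigenvalue (M^T *m M) (s ^+ 2)].

(* The sets below are finite, so [sup] and [inf] are a maximum and a minimum
   whenever the set is nonempty (they are 0 by convention otherwise). *)
Definition sigma_max (R : realType) (m q : nat) (M : 'M[R]_(m, q)) : R :=
  sup (singular_values M).

Definition sigma_min (R : realType) (m q : nat) (M : 'M[R]_(m, q)) : R :=
  inf [set s | singular_values M s /\ s != 0].

Definition eta_min (R : realType) (m : nat) (M : 'M[R]_m) : R :=
  inf [set a | eigenvalue M a /\ a != 0].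

(** * The problem

   R^d with d = \sum_i d_i is ['cV_(\sum_i d i)], R^{np} is
   ['cV_(\sum_(i < n) p)], and the i-th block of a stacked vector x is
   [submxcol x i]. *)

Definition sumf (R : realType) (n : nat) (d : 'I_n -> nat)
    (f : forall i, 'cV[R]_(d i) -> R) (x : 'cV[R]_(\sum_i d i)) : R :=
  \sum_i f i (submxcol x i).

Definition sumg (R : realType) (n : nat) (d : 'I_n -> nat)
    (g : forall i, 'cV[R]_(d i) -> \bar R) (x : 'cV[R]_(\sum_i d i)) : \bar R :=
  (\sum_i g i (submxcol x i))%E.

Definition rowA (R : realType) (n p : nat) (d : 'I_n -> nat)
    (A : forall i, 'M[R]_(p, d i)) : 'M[R]_(p, \sum_i d i) :=
  \mxrow_i A i.

(* [mxdiag] only handles square diagonal blocks. *)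
Definition diagA (R : realType) (n p : nat) (d : 'I_n -> nat)
    (A : forall i, 'M[R]_(p, d i)) : 'M[R]_(\sum_(i < n) p, \sum_i d i) :=
  \mxblock_(i < n, j < n) (if i == j then A j else 0).

(* The Kronecker product of M and the identity matrix of size p. *)
Definition kron1 (R : realType) (n p : nat) (M : 'M[R]_n) :
    'M[R]_(\sum_(i < n) p) :=
  \mxblock_(i < n, j < n) ((M i j)%:M : 'M[R]_p).

Definition objective (R : realType) (n p : nat) (d : 'I_n -> nat)
    (f : forall i, 'cV[R]_(d i) -> R) (g : forall i, 'cV[R]_(d i) -> \bar R)
    (h : 'cV[R]_p -> \bar R) (A : forall i, 'M[R]_(p, d i))
    (x : 'cV[R]_(\sum_i d i)) : \bar R :=
  ((sumf f x)%:E + sumg g x + h (rowA A *m x))%E.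

Definition lagrangian (R : realType) (n p : nat) (d : 'I_n -> nat)
    (f : forall i, 'cV[R]_(d i) -> R) (g : forall i, 'cV[R]_(d i) -> \bar R)
    (h : 'cV[R]_p -> \bar R) (A : forall i, 'M[R]_(p, d i))
    (x : 'cV[R]_(\sum_i d i)) (la : 'cV[R]_p) : \bar R :=
  ((sumf f x)%:E + sumg g x + (dotp la (rowA A *m x))%:E - fenchel h la)%E.

Definition saddle_point (R : realType) (X Y : Type) (L : X -> Y -> \bar R)
    (xs : X) (ys : Y) : Prop :=
  (forall y, (L xs y <= L xs ys)%E) /\ (forall x, (L xs ys <= L x ys)%E).

(** * The NPGA iteration *)

Definition hbold (R : realType) (n p : nat) (h : 'cV[R]_p -> \bar R)
    (la : 'cV[R]_(\sum_(i < n) p)) : \bar R :=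
  ((n%:R^-1)%:E * \sum_(i < n) fenchel h (submxcol la i))%E.

Record npga_state (R : realType) (n p : nat) (d : 'I_n -> nat) := NPGAState {
  npga_x : 'cV[R]_(\sum_i d i);
  npga_y : 'cV[R]_(\sum_(i < n) p);
  npga_la : 'cV[R]_(\sum_(i < n) p)
}.

Definition npga_step (R : realType) (n p : nat) (d : 'I_n -> nat)
    (f : forall i, 'cV[R]_(d i) -> R) (g : forall i, 'cV[R]_(d i) -> \bar R)
    (h : 'cV[R]_p -> \bar R) (A : forall i, 'M[R]_(p, d i))
    (B C D : 'M[R]_n) (alpha beta gamma theta : R)
    (s : npga_state R p d) : npga_state R p d :=
  let: NPGAState x y la := s in
  let x' := prox alpha (sumg g)
              (x - alpha *: (grad (sumf f) x + (diagA A)^T *m la)) in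
  let xhat := x' + theta *: (x' - x) in
  let v := la - kron1 p C *m la - kron1 p B *m y
             + beta *: (diagA A *m xhat) in
  let y' := y + gamma *: (kron1 p B *m v) in
  let la' := prox beta (hbold h) (kron1 p D *m v) in
  NPGAState x' y' la'.

Definition npga (R : realType) (n p : nat) (d : 'I_n -> nat)
    (f : forall i, 'cV[R]_(d i) -> R) (g : forall i, 'cV[R]_(d i) -> \bar R)
    (h : 'cV[R]_p -> \bar R) (A : forall i, 'M[R]_(p, d i))
    (B C D : 'M[R]_n) (alpha beta gamma theta : R)
    (x0 : 'cV[R]_(\sum_i d i)) (y0 la0 : 'cV[R]_(\sum_(i < n) p)) (k : nat) :
    npga_state R p d :=
  iter k (npga_step f g h A B C D alpha beta gamma theta)
    (NPGAState x0 y0 la0).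

(* Main.v *)
Require Import Defs.
From HB Require Import structures.
From mathcomp Require Import all_boot all_order all_algebra.
From mathcomp Require Import all_classical all_reals all_analysis.
From mathcomp Require Import ring lra.

Set Implicit Arguments.
Unset Strict Implicit.
Unset Printing Implicit Defensive.

Import Order.TTheory GRing.Theory Num.Theory.
Import numFieldNormedType.Exports.

Local Open Scope classical_set_scope.
Local Open Scope ring_scope.

(* Since g = 0 and h is the indicator of {b}, both proximal maps are translations
   and the iteration is affine apart from the gradient of f.  Writing x, v, y, la
   for the errors with respect to a fixed point, one has la = D v after the first
   step, and

     V = (1 - alpha mu) |x|^2
         + alpha / beta (|v|^2 - gamma |B v|^2 + |y|^2 / gamma)

   satisfies V' <= delta V: the cross terms 2 alpha <la, A x'> of the primal and
   dual steps cancel, cocoercivity of the gradient contracts x, the condition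
   D (I - C) D <= I - B^2 bounds the v-part by |v|^2 - gamma |B v|^2
   - alpha beta <v, F v> with F positive definite, and y stays in the range of B
   because y^0 = 0. *)

(** * Quadratic forms *)

(** The dual error is measured in v because D may be singular: [la = D v] loses information, while
    condition (7) and F give quadratic forms in v. The weight of |x|^2 is dictated by the dual step.
    That step leaves beta^2 / (1 - sigma_max C) |A x'|^2, which the bound on beta turns into beta mu
    |x'|^2; scaled by alpha / beta, this is alpha mu |x'|^2 and moves to the left-hand side, leaving
    1 - alpha mu. The gradient step must therefore contract by (1 - alpha mu) delta, not merely by
    delta. Both halves of F are terms that cruder estimates drop. The A A^T half is the negative
    square that appears when |x'|^2 is expanded around the new point; the B^2 half is the slack
    between |v|^2 - |B v|^2, the bound from condition (7), and |v|^2 - gamma |B v|^2. The spectral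
    constants are bounds of sets of eigenvalues, whereas the estimates use inequalities between
    quadratic forms; extremal Rayleigh quotients connect the two. *)

Section Dotp.
Variables (R : realType) (m : nat).
Implicit Types (u v w : 'cV[R]_m) (a : R).

Lemma dotpE u v : dotp u v = \sum_i u i 0 * v i 0.
Proof. by rewrite /dotp mxE; apply: eq_bigr => i _; rewrite mxE. Qed.

Lemma dotpC u v : dotp u v = dotp v u.
Proof. by rewrite !dotpE; apply: eq_bigr => i _; rewrite mulrC. Qed.

Lemma dotpDl u v w : dotp (u + v) w = dotp u w + dotp v w.
Proof. by rewrite /dotp linearD mulmxDl mxE. Qed.

Lemma dotpZl a u v : dotp (a *: u) v = a * dotp u v.
Proof. by rewrite /dotp linearZ -scalemxAl mxE. Qed.

Lemma dotpNl u v : dotp (- u) v = - dotp u v.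
Proof. by rewrite -scaleN1r dotpZl mulN1r. Qed.

Lemma dotpDr u v w : dotp u (v + w) = dotp u v + dotp u w.
Proof. by rewrite !(dotpC u) dotpDl. Qed.

Lemma dotpZr a u v : dotp u (a *: v) = a * dotp u v.
Proof. by rewrite !(dotpC u) dotpZl. Qed.

Lemma dotpNr u v : dotp u (- v) = - dotp u v.
Proof. by rewrite !(dotpC u) dotpNl. Qed.

Lemma dotp0l u : dotp 0 u = 0.
Proof. by rewrite -(scale0r 0) dotpZl mul0r. Qed.

Lemma dotp0r u : dotp u 0 = 0.
Proof. by rewrite dotpC dotp0l. Qed.

Definition dotp_lin :=
  (dotpDl, dotpDr, dotpZl, dotpZr, dotpNl, dotpNr, dotp0l, dotp0r).

Lemma dotp_ge0 u : 0 <= dotp u u.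
Proof. by rewrite dotpE sumr_ge0 // => i _; rewrite -expr2 sqr_ge0. Qed.

Lemma dotp_eq0 u : dotp u u = 0 -> u = 0.
Proof.
rewrite dotpE => /eqP; rewrite psumr_eq0; last first.
  by move=> i _; rewrite -expr2 sqr_ge0.
move=> /allP u0; apply/colP => i; rewrite mxE; apply/eqP.
have := u0 i; rewrite mem_index_enum => /(_ isT) /=.
by rewrite mulf_eq0 orbb.
Qed.

Lemma dotp_gt0 u : u != 0 -> 0 < dotp u u.
Proof.
by move=> u0; rewrite lt_def dotp_ge0 andbT; apply: contra_neq u0 => /dotp_eq0.
Qed.

Lemma enorm_sqr u : enorm u ^+ 2 = dotp u u.
Proof. by rewrite sqr_sqrtr // dotp_ge0. Qed.

Lemma dotp_delta u i : dotp u (delta_mx i 0) = u i 0.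
Proof.
rewrite dotpE (bigD1 i) //= mxE !eqxx mulr1 big1 ?addr0 // => j ji.
by rewrite mxE (negPf ji) mulr0.
Qed.

End Dotp.

Lemma dotp_mull (R : realType) m q (M : 'M[R]_(m, q)) u v :
  dotp (M *m u) v = dotp u (M^T *m v).
Proof. by rewrite /dotp trmx_mul mulmxA. Qed.

Lemma dotp_mulr (R : realType) m q (M : 'M[R]_(m, q)) u v :
  dotp u (M *m v) = dotp (M^T *m u) v.
Proof. by rewrite dotp_mull trmxK. Qed.

(** Each case tests the polynomial at one point: where it equals -1 if b = 0 and c < 0, where its
    affine part equals -1 if b is nonzero and c <= 0, and at its vertex if c > 0. *)
Lemma quad_nonneg_discr (R : realType) (a b c : R) :
  (forall t : R, 0 <= a + 2 * t * b + t ^+ 2 * c) -> b ^+ 2 <= a * c.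
Proof.
move=> h.
have a0 : 0 <= a by have := h 0; rewrite expr0n /= mulr0 !mul0r !addr0.
have [b0|b0] := eqVneq b 0.
  have c0 : 0 <= c.
    rewrite leNgt; apply/negP => c0.
    have d0 : 0 < (a + 1) / (- c) by rewrite divr_gt0 ?oppr_gt0 // ltr_wpDl.
    have := h (Num.sqrt ((a + 1) / (- c))).
    rewrite b0 mulr0 addr0 sqr_sqrtr; last exact: ltW.
    have -> : a + (a + 1) / (- c) * c = -1 by field; rewrite lt_eqF.
    lra.
  by rewrite b0 expr0n mulr_ge0.
have b20 : 0 < b ^+ 2 by rewrite exprn_even_gt0.
have [c0|c0] := leP c 0.
  have := h (- (a + 1) / (2 * b)).
  have -> : a + 2 * (- (a + 1) / (2 * b)) * b = -1 by field.
  have : (- (a + 1) / (2 * b)) ^+ 2 * c <= 0 by rewrite mulr_ge0_le0 // sqr_ge0.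
  lra.
have := h (- b / c).
have -> : a + 2 * (- b / c) * b + (- b / c) ^+ 2 * c = (a * c - b ^+ 2) / c.
  by field; rewrite gt_eqF.
by rewrite pmulr_lge0 ?invr_gt0 // subr_ge0.
Qed.

Lemma psd_cauchy_schwarz (R : realType) m (M : 'M[R]_m) u v : M^T = M ->
  (forall z, 0 <= dotp z (M *m z)) ->
  dotp u (M *m v) ^+ 2 <= dotp u (M *m u) * dotp v (M *m v).
Proof.
move=> sM pM; apply: quad_nonneg_discr => t.
have := pM (u + t *: v).
rewrite mulmxDr -scalemxAr !dotp_lin (dotpC v (M *m u)) dotp_mull sM.
by congr (0 <= _); ring.
Qed.

(** Only the existence of K matters: it makes Rayleigh quotients bounded. The summand 1 keeps K
    positive, so that it can serve as a divisor. *)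
Lemma quad_form_bound (R : realType) m (M : 'M[R]_m) :
  exists2 K : R, 0 < K & forall z, `|dotp z (M *m z)| <= K * dotp z z.
Proof.
exists (1 + \sum_i \sum_j `|M i j|).
  by rewrite ltr_pwDl // sumr_ge0 // => i _; rewrite sumr_ge0.
move=> z.
have zi i : `|z i 0| <= Num.sqrt (dotp z z).
  rewrite -sqrtr_sqr ler_wsqrtr // dotpE (bigD1 i) //= -expr2 lerDl sumr_ge0 //.
  by move=> j _; rewrite -expr2 sqr_ge0.
rewrite mulrDl mul1r ler_wpDl ?dotp_ge0 // dotpE (le_trans (ler_norm_sum _ _ _))//.
rewrite mulr_suml ler_sum // => i _; rewrite mxE mulr_sumr.
rewrite (le_trans (ler_norm_sum _ _ _))// mulr_suml ler_sum // => j _.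
rewrite !normrM mulrCA ler_wpM2l // -[leRHS]sqr_sqrtr ?dotp_ge0 // expr2.
by rewrite ler_pM.
Qed.

(* No compactness is used: if the infimum r of the Rayleigh quotient were not
   an eigenvalue, N = M - r would be invertible, and Cauchy-Schwarz for the form
   N applied to z and N^-1 z would bound the quotient of N away from 0. *)
Lemma rayleigh_min (R : realType) m (M : 'M[R]_m) : (0 < m)%N -> M^T = M ->
  exists r (z : 'cV[R]_m), [/\ z != 0, M *m z = r *: z
    & forall u, r * dotp u u <= dotp u (M *m u)].
Proof.
move=> m0 sM.
have [K K0 MK] := quad_form_bound M.
pose S := [set dotp z (M *m z) / dotp z z | z in [set z : 'cV[R]_m | z != 0]].
pose r := inf S.
have hiS : has_inf S.
  split; last first.
    exists (- K) => _ [z /= z0 <-].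
    rewrite ler_pdivlMr ?dotp_gt0 // mulNr.
    by have := MK z; rewrite ler_norml => /andP[].
  have i0 : 'I_m by exact: (Ordinal m0).
  exists (dotp (delta_mx i0 0) (M *m delta_mx i0 0) /
          dotp (delta_mx i0 0) (delta_mx i0 0 : 'cV[R]_m)).
  exists (delta_mx i0 0) => //=.
  apply/eqP => /matrixP /(_ i0 0); rewrite !mxE !eqxx => /eqP.
  by rewrite oner_eq0.
have rM u : r * dotp u u <= dotp u (M *m u).
  have [->|u0] := eqVneq u 0; first by rewrite !dotp0l mulr0.
  rewrite -ler_pdivlMr ?dotp_gt0 //; apply: ge_inf; first by case: hiS.
  by exists u.
exists r; pose N := M - r%:M.
have NE u v : dotp u (N *m v) = dotp u (M *m v) - r * dotp u v.
  by rewrite mulmxBl mul_scalar_mx !dotp_lin.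
have sN : N^T = N by rewrite linearB /= sM tr_scalar_mx.
have pN z : 0 <= dotp z (N *m z) by rewrite NE subr_ge0.
have [Nu|/negP] := boolP (N \in unitmx); last first.
  move=> /negP; rewrite -row_free_unit -kermx_eq0 => /rowV0Pn[v vN v0].
  exists v^T; split => //; first by rewrite -trmx0 (inj_eq trmx_inj).
  apply/eqP; rewrite -subr_eq0 -mul_scalar_mx -mulmxBl -/N.
  by rewrite -[N]sN -trmx_mul (sub_kermxP vN) trmx0.
exfalso.
have [K' K'0 NK] := quad_form_bound (invmx N).
have lb z : dotp z z / K' <= dotp z (N *m z).
  have [->|z0] := eqVneq z 0; first by rewrite !dotp0l mul0r.
  have z1 := dotp_gt0 z0.
  have := psd_cauchy_schwarz z (invmx N *m z) sN pN.
  rewrite mulKVmx // (dotpC _ z) => h.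
  rewrite ler_pdivrMr // -(ler_pM2r z1) -expr2 (le_trans h) // -mulrA.
  rewrite ler_wpM2l //.
  by have := NK z; rewrite ler_norml => /andP[].
have : r + K'^-1 <= r.
  apply: lb_le_inf; first by case: hiS.
  move=> _ [z /= z0 <-]; rewrite ler_pdivlMr ?dotp_gt0 //.
  by have := lb z; rewrite NE mulrDl; lra.
by rewrite gerDl invr_le0 leNgt K'0.
Qed.

(** * Extreme eigenvalues and singular values *)

(** [eigenvalue] is about row vectors; symmetry and transposition give the column form used with
    [dotp]. *)
Lemma sym_eigenvalueP (R : realType) m (M : 'M[R]_m) a : M^T = M ->
  eigenvalue M a <-> exists2 z : 'cV[R]_m, M *m z = a *: z & z != 0.
Proof.
move=> sM; split.
  case/eigenvalueP => v vM v0; exists v^T.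
    by rewrite -{1}sM -trmx_mul vM linearZ.
  by rewrite -trmx0 (inj_eq trmx_inj).
case=> z zM z0; apply/eigenvalueP; exists z^T.
  by rewrite -{1}sM -trmx_mul zM linearZ.
by rewrite -trmx0 (inj_eq trmx_inj).
Qed.

Lemma rayleigh_max (R : realType) m (M : 'M[R]_m) : (0 < m)%N -> M^T = M ->
  exists r (z : 'cV[R]_m), [/\ z != 0, M *m z = r *: z
    & forall u, dotp u (M *m u) <= r * dotp u u].
Proof.
move=> m0 sM; have sN : (- M)^T = - M by rewrite linearN /= sM.
have [r [z [z0 zM rM]]] := rayleigh_min m0 sN.
exists (- r), z; split => //.
  by apply: oppr_inj; rewrite -mulNmx zM scaleNr opprK.
by move=> u; have := rM u; rewrite mulNmx dotpNr mulNr lerNr.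
Qed.

Lemma dotp_gram (R : realType) m q (M : 'M[R]_(m, q)) u :
  dotp u (M^T *m M *m u) = dotp (M *m u) (M *m u).
Proof. by rewrite -mulmxA dotp_mulr trmxK. Qed.

Lemma tr_gram (R : realType) m q (M : 'M[R]_(m, q)) : (M^T *m M)^T = M^T *m M.
Proof. by rewrite trmx_mul trmxK. Qed.

(** When the set is empty or unbounded, [sup] takes its default value 0, so the inequality holds in
    every case. *)
Lemma sigma_max_ge0 (R : realType) m q (M : 'M[R]_(m, q)) : 0 <= sigma_max M.
Proof.
have [[x Sx]|S0] := pselect (singular_values M !=set0).
  have [ub|nub] := pselect (has_ubound (singular_values M)).
    by apply: le_trans (ub_le_sup ub Sx); case: Sx.
  by rewrite /sigma_max sup_out // => -[].
by rewrite /sigma_max sup_out // => -[].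
Qed.

Lemma sigma_max_bound (R : realType) m q (M : 'M[R]_(m, q)) u :
  dotp (M *m u) (M *m u) <= sigma_max M ^+ 2 * dotp u u.
Proof.
case: q M u => [|q] M u.
  by rewrite (flatmx0 u) mulmx0 !dotp0l mulr0.
have [r [z [z0 zM rM]]] := rayleigh_max (ltn0Sn q) (tr_gram M).
have r0 : 0 <= r.
  rewrite -(pmulr_lge0 _ (dotp_gt0 z0)) -dotpZr -zM dotp_gram.
  exact: dotp_ge0.
(* [ub_le_sup] needs an upper bound: the [sup] of an unbounded set would be the default 0. *)
have ub : has_ubound (singular_values M).
  exists (Num.sqrt r) => s [s0 /(sym_eigenvalueP _ (tr_gram M))[w wM w0]].
  rewrite -(ger0_norm s0) -sqrtr_sqr ler_wsqrtr //.
  by rewrite -(ler_pM2r (dotp_gt0 w0)) -dotpZr -wM.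
have : r <= sigma_max M ^+ 2.
  rewrite -[r]sqr_sqrtr // lerXn2r ?nnegrE ?sqrtr_ge0 ?sigma_max_ge0 //.
  apply: ub_le_sup => //; split; first exact: sqrtr_ge0.
  by rewrite sqr_sqrtr //; apply/sym_eigenvalueP; [exact: tr_gram|exists z].
move=> /(ler_wpM2r (dotp_ge0 u)); apply: le_trans.
by rewrite -dotp_gram.
Qed.

Lemma dotp_cauchy_schwarz (R : realType) m (u v : 'cV[R]_m) :
  dotp u v ^+ 2 <= dotp u u * dotp v v.
Proof.
have := @psd_cauchy_schwarz R m 1%:M u v; rewrite trmx1 => /(_ erefl).
by rewrite !mul1mx; apply => z; rewrite mul1mx dotp_ge0.
Qed.

Lemma sigma_max_quad (R : realType) m (M : 'M[R]_m) u :
  dotp u (M *m u) <= sigma_max M * dotp u u.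
Proof.
rewrite (le_trans (ler_norm _)) // -ler_sqr ?nnegrE ?normr_ge0 //; last first.
  by rewrite mulr_ge0 ?sigma_max_ge0 ?dotp_ge0.
rewrite real_normK ?num_real // (le_trans (dotp_cauchy_schwarz _ _)) //.
rewrite exprMn (expr2 (dotp u u)) mulrA mulrC.
by rewrite ler_wpM2r ?dotp_ge0 // sigma_max_bound.
Qed.

(** Positive definiteness excludes the eigenvalue 0, so the smallest nonzero eigenvalue is the
    minimum of the Rayleigh quotient. *)
Lemma eta_min_pd (R : realType) m (M : 'M[R]_m) : (0 < m)%N -> pdmx M ->
  0 < eta_min M /\ forall u, eta_min M * dotp u u <= dotp u (M *m u).
Proof.
move=> m0 [sM pM]; have [r [z [z0 zM rM]]] := rayleigh_min m0 sM.
have r0 : 0 < r by rewrite -(pmulr_lgt0 _ (dotp_gt0 z0)) -dotpZr -zM pM.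
pose S := [set a : R | eigenvalue M a /\ a != 0].
have Sr : S r.
  by split; [apply/sym_eigenvalueP => //; exists z|rewrite gt_eqF].
have lbS : lbound S r.
  move=> a [/(sym_eigenvalueP _ sM)[w wM w0] _].
  by rewrite -(ler_pM2r (dotp_gt0 w0)) -[leRHS]dotpZr -wM.
have re : eta_min M = r.
  apply/eqP; rewrite eq_le; apply/andP; split.
    by apply: ge_inf => //; exists r.
  by apply: lb_le_inf => //; exists r.
by rewrite re.
Qed.

Section NullSpan1.
Variables (R : realType) (n : nat) (B : 'M[R]_n).
Hypotheses (sB : B^T = B) (nB : null_span1 B).
Local Notation one := (const_mx 1 : 'cV[R]_n).

Lemma null_span1_mul : B *m one = 0.
Proof. by apply/nB; exists 1; rewrite scale1r. Qed.

Lemma dotp_one_mul u : dotp one (B *m u) = 0.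
Proof. by rewrite dotp_mulr sB null_span1_mul dotp0l. Qed.

Lemma const1_mul (u : 'cV[R]_n) : const_mx 1 *m u = dotp one u *: one.
Proof.
apply/colP => i; rewrite !mxE mulr1 dotpE.
by apply: eq_bigr => j _; rewrite !mxE.
Qed.

Lemma dotp_one_one : dotp one one = n%:R.
Proof.
rewrite dotpE; under eq_bigr do rewrite !mxE mulr1.
by rewrite sumr_const card_ord.
Qed.

Lemma tr_const1 : (const_mx 1 : 'M[R]_n)^T = const_mx 1.
Proof. by apply/matrixP => i j; rewrite !mxE. Qed.

(** Adding the all-ones matrix makes B invertible without changing it on the orthogonal complement
    of 1, and the sum preserves the component along 1 up to the factor n; its inverse therefore
    solves the equation inside that complement. *)
Lemma null_span1_surj u : (0 < n)%N -> dotp one u = 0 ->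
  exists2 w, dotp one w = 0 & B *m w = u.
Proof.
move=> n0 u0; pose G := B + const_mx 1.
have n0R : n%:R != 0 :> R by rewrite pnatr_eq0 -lt0n.
have one_G w : dotp one (G *m w) = n%:R * dotp one w.
  by rewrite mulmxDl const1_mul !dotp_lin dotp_one_mul dotp_one_one add0r mulrC.
have Gw w : dotp one (G *m w) = 0 -> dotp one w = 0 /\ G *m w = B *m w.
  rewrite one_G => /eqP; rewrite mulf_eq0 (negPf n0R) /= => /eqP w0.
  by rewrite mulmxDl const1_mul w0 scale0r addr0.
have uG : G \in unitmx.
  rewrite -row_free_unit -kermx_eq0; apply/negPn/negP => /rowV0Pn[v vG v0].
  have Gv : G *m v^T = 0.
    have sG : G^T = G by rewrite linearD /= sB tr_const1.
    by rewrite -sG -trmx_mul (sub_kermxP vG) trmx0.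
  have [] := Gw v^T; first by rewrite Gv dotp0r.
  rewrite Gv => vone /esym /nB[c vc].
  move: vone; rewrite vc dotpZr dotp_one_one => /eqP.
  rewrite mulf_eq0 (negPf n0R) orbF => /eqP c0.
  by move: v0; rewrite -(inj_eq trmx_inj) vc c0 scale0r trmx0 eqxx.
exists (invmx G *m u); last first.
  by have [] := Gw (invmx G *m u); rewrite mulKVmx.
by have [] := Gw (invmx G *m u); rewrite mulKVmx.
Qed.

(* The rank-one perturbation c 1 1^T pushes the kernel direction out of the way:
   the smallest eigenvalue of B^2 + c 1 1^T is the smallest nonzero one of B^2. *)
Lemma sigma_min_null_span1 : (1 < n)%N ->
  0 < sigma_min B /\
  forall u, dotp one u = 0 ->
    sigma_min B ^+ 2 * dotp u u <= dotp (B *m u) (B *m u).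
Proof.
move=> n1; have n0 : (0 < n)%N by exact: ltnW.
have n0R : 0 < n%:R :> R by rewrite ltr0n.
have [K K0 BK] := quad_form_bound (B^T *m B).
pose c := K + 1; pose G := B^T *m B + c *: const_mx 1.
have sG : G^T = G by rewrite linearD /= tr_gram linearZ /= tr_const1.
have GE u : G *m u = B^T *m B *m u + (c * dotp one u) *: one.
  by rewrite mulmxDl -scalemxAl const1_mul scalerA.
have one_G u : dotp one (G *m u) = c * n%:R * dotp one u.
  rewrite GE !dotp_lin -mulmxA dotp_mulr trmxK null_span1_mul dotp0l add0r.
  by rewrite dotp_one_one; ring.
have G0 u : dotp one u = 0 -> G *m u = B^T *m B *m u.
  by move=> u0; rewrite GE u0 mulr0 scale0r addr0.
have [r [z [z0 zG rG]]] := rayleigh_min n0 sG.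
have z1 : dotp one z = 0.
  apply/eqP; apply: contraT => z1; exfalso.
  have rE : r = c * n%:R.
    by apply: (mulIf z1); rewrite -one_G zG dotpZr.
  (* This is where n > 1 enters: the difference of two basis vectors is orthogonal to 1, so its
     quotient is at most K, below the value r = (K + 1) n that an eigenvector with a component along
     1 would force. *)
  pose i0 := Ordinal n0; pose i1 := Ordinal n1.
  pose u : 'cV[R]_n := delta_mx i0 0 - delta_mx i1 0.
  have u1 : dotp one u = 0 by rewrite !dotp_lin !dotp_delta !mxE subrr.
  have u0 : u != 0.
    apply/eqP => /matrixP /(_ i0 0); rewrite !mxE !eqxx /= subr0 => /eqP.
    by rewrite oner_eq0.
  have := rG u; rewrite G0 // => h.
  have := BK u; rewrite ler_norml => /andP[_ /(le_trans h)].
  rewrite ler_pM2r ?dotp_gt0 // rE /c.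
  have : 1 <= n%:R :> R by rewrite ler1n.
  by nra.
have zB : B^T *m B *m z = r *: z by rewrite -G0.
have lb u : dotp one u = 0 -> r * dotp u u <= dotp (B *m u) (B *m u).
  by move=> u0; rewrite -dotp_gram -G0.
have r0 : 0 < r.
  rewrite lt_def; apply/andP; split; last first.
    rewrite -(pmulr_lge0 _ (dotp_gt0 z0)) -dotpZr -zB dotp_gram.
    exact: dotp_ge0.
  apply/eqP => r0; move: zB; rewrite r0 scale0r => zB.
  have /nB[a za] : B *m z = 0.
    by apply: dotp_eq0; rewrite -dotp_gram zB dotp0r.
  move: z1; rewrite za dotpZr dotp_one_one => /eqP.
  rewrite mulf_eq0 (gt_eqF n0R) orbF => /eqP a0.
  by move: z0; rewrite za a0 scale0r eqxx.
have srE : Num.sqrt r ^+ 2 = r by rewrite sqr_sqrtr // ltW.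
have lbS : lbound [set s | singular_values B s /\ s != 0] (Num.sqrt r).
  move=> s [[s0 /(sym_eigenvalueP _ (tr_gram B))[w wB w0]] sn0].
  have w1 : dotp one w = 0.
    have : dotp one (s ^+ 2 *: w) = 0.
      by rewrite -wB -mulmxA dotp_mulr trmxK null_span1_mul dotp0l.
    by rewrite dotpZr => /eqP; rewrite mulf_eq0 expf_eq0 (negPf sn0) => /eqP.
  rewrite -(ger0_norm s0) -sqrtr_sqr ler_wsqrtr //.
  by rewrite -(ler_pM2r (dotp_gt0 w0)) -[leRHS]dotpZr -wB dotp_gram lb.
have Sr : [set s | singular_values B s /\ s != 0] (Num.sqrt r).
  split; last by rewrite gt_eqF // sqrtr_gt0.
  split; first exact: sqrtr_ge0.
  by rewrite srE; apply/sym_eigenvalueP; [exact: tr_gram|exists z].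
have -> : sigma_min B = Num.sqrt r.
  apply/eqP; rewrite eq_le; apply/andP; split.
    by apply: ge_inf => //; exists (Num.sqrt r).
  by apply: lb_le_inf => //; exists (Num.sqrt r).
by rewrite sqrtr_gt0 srE.
Qed.

End NullSpan1.

(** * Block vectors *)

Lemma col_mulmx (R : pzRingType) m q r (M : 'M[R]_(m, q)) (N : 'M[R]_(q, r)) j :
  col j (M *m N) = M *m col j N.
Proof. by rewrite !colE mulmxA. Qed.

Section Blocks.
Variables (R : realType) (n : nat) (d : 'I_n -> nat).
Implicit Types (u v : 'cV[R]_(\sum_i d i)).

Lemma submxcolZ (a : R) u i : submxcol (a *: u) i = a *: submxcol u i.
Proof. by apply/matrixP => j k; rewrite !mxE. Qed.

Lemma submxcol_inj u v : (forall i, submxcol u i = submxcol v i) -> u = v.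
Proof. by move=> uv; apply/mxcolP. Qed.

Lemma dotp_blocks u v : dotp u v = \sum_i dotp (submxcol u i) (submxcol v i).
Proof.
rewrite /dotp -[in LHS](submxcolK u) -[in LHS](submxcolK v) tr_mxcol.
by rewrite mul_mxrow_mxcol summxE.
Qed.

Variables (p : nat) (A : forall i, 'M[R]_(p, d i)).

Lemma rowA_mul u : rowA A *m u = \sum_i A i *m submxcol u i.
Proof. by rewrite -[in LHS](submxcolK u) mul_mxrow_mxcol. Qed.

Lemma tr_rowA_mul (v : 'cV[R]_p) i :
  submxcol ((rowA A)^T *m v) i = (A i)^T *m v.
Proof. by rewrite tr_mxrow mxcol_mul mxcolK. Qed.

Lemma diagA_mul u i : submxcol (diagA A *m u) i = A i *m submxcol u i.
Proof.
rewrite /diagA mxblockEh -[in LHS](submxcolK u) mul_mxrow_mxcol submxcol_sum.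
rewrite (bigD1 i) //= [X in _ + X]big1.
  by rewrite addr0 -submxcol_mul mxcolK eqxx.
by move=> j ji; rewrite -submxcol_mul mxcolK eq_sym (negPf ji) mul0mx.
Qed.

Lemma tr_diagA_mul (v : 'cV[R]_(\sum_(i < n) p)) i :
  submxcol ((diagA A)^T *m v) i = (A i)^T *m submxcol v i.
Proof.
rewrite /diagA tr_mxblock mxblockEh -[in LHS](submxcolK v) mul_mxrow_mxcol.
rewrite submxcol_sum (bigD1 i) //= [X in _ + X]big1.
  by rewrite addr0 -submxcol_mul mxcolK eqxx.
by move=> j ji; rewrite -submxcol_mul mxcolK (negPf ji) trmx0 mul0mx.
Qed.

End Blocks.

(** * Kronecker products with the identity *)

Section Kron.
Variables (R : realType) (n p : nat).
Implicit Types (u v : 'cV[R]_(\sum_(i < n) p)) (M N : 'M[R]_n).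

(* The i-th row is the transpose of the i-th block, so that [kron1 p M] becomes
   the left multiplication by M. *)
Definition unstack u : 'M[R]_(n, p) := \matrix_(i, j) submxcol u i j 0.
Definition stack (Y : 'M[R]_(n, p)) : 'cV[R]_(\sum_(i < n) p) :=
  \mxcol_i (row i Y)^T.

Lemma submxcol_stack Y i : submxcol (stack Y) i = (row i Y)^T.
Proof. exact: mxcolK. Qed.

Lemma stackK : cancel stack unstack.
Proof. by move=> Y; apply/matrixP => i j; rewrite mxE submxcol_stack !mxE. Qed.

Lemma unstackK : cancel unstack stack.
Proof.
move=> u; apply: submxcol_inj => i; rewrite submxcol_stack.
by apply/colP => j; rewrite !mxE.
Qed.

Lemma unstack_inj : injective unstack.
Proof. exact: can_inj unstackK. Qed.

Lemma unstackD u v : unstack (u + v) = unstack u + unstack v.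
Proof. by apply/matrixP => i j; rewrite !mxE. Qed.

Lemma unstackZ a u : unstack (a *: u) = a *: unstack u.
Proof. by apply/matrixP => i j; rewrite !mxE. Qed.

Lemma unstack0 : unstack 0 = 0.
Proof. by apply/matrixP => i j; rewrite !mxE. Qed.

Lemma unstack_kron1 M u : unstack (kron1 p M *m u) = M *m unstack u.
Proof.
apply/matrixP => i j; rewrite [LHS]mxE /kron1 mxblockEh -[in LHS](submxcolK u).
rewrite mul_mxrow_mxcol submxcol_sum summxE mxE; apply: eq_bigr => k _.
by rewrite -submxcol_mul mxcolK mul_scalar_mx !mxE.
Qed.

Lemma tr_kron1 M : (kron1 p M)^T = kron1 p M^T.
Proof.
rewrite /kron1 tr_mxblock; apply/eq_mxblock => i j.
by rewrite tr_scalar_mx mxE.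
Qed.

Lemma dotp_unstack u v :
  dotp u v = \sum_j dotp (col j (unstack u)) (col j (unstack v)).
Proof.
rewrite dotp_blocks; under eq_bigr do rewrite dotpE.
rewrite exchange_big; apply: eq_bigr => j _; rewrite dotpE.
by apply: eq_bigr => i _; rewrite !mxE.
Qed.

(** The columns of [unstack] are p independent copies of R^n on which M acts, so inequalities
    between n by n forms carry over by summation. *)
Lemma dotp_kron1 M u v : dotp u (kron1 p M *m v) =
  \sum_j dotp (col j (unstack u)) (M *m col j (unstack v)).
Proof.
by rewrite dotp_unstack unstack_kron1; apply: eq_bigr => j _; rewrite -col_mulmx.
Qed.

Lemma kron1_mul M N u : kron1 p M *m (kron1 p N *m u) = kron1 p (M *m N) *m u.
Proof. by apply: unstack_inj; rewrite !unstack_kron1 mulmxA. Qed.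

Lemma kron1_sub M N u : kron1 p (M - N) *m u = kron1 p M *m u - kron1 p N *m u.
Proof.
apply: unstack_inj.
rewrite unstack_kron1 -[- (kron1 p N *m u)]scaleN1r unstackD unstackZ.
by rewrite !unstack_kron1 mulmxBl scaleN1r.
Qed.

Lemma kron1_1 u : kron1 p 1%:M *m u = u.
Proof. by apply: unstack_inj; rewrite unstack_kron1 mul1mx. Qed.

Lemma kron1_psd M u : psdmx M -> 0 <= dotp u (kron1 p M *m u).
Proof. by case=> _ pM; rewrite dotp_kron1 sumr_ge0. Qed.

Lemma kron1_le M N u : mxle M N ->
  dotp u (kron1 p M *m u) <= dotp u (kron1 p N *m u).
Proof.
by move=> MN; rewrite -subr_ge0 -dotpNr -dotpDr -kron1_sub kron1_psd.
Qed.

Definition repeat_cV (c : 'cV[R]_p) : 'cV[R]_(\sum_(i < n) p) := \mxcol_i c.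

Lemma submxcol_repeat c i : submxcol (repeat_cV c) i = c.
Proof. exact: mxcolK. Qed.

Lemma unstack_repeat c : unstack (repeat_cV c) = const_mx 1 *m c^T.
Proof.
apply/matrixP => i j; rewrite mxE submxcol_repeat mxE big_ord1 !mxE mul1r.
by [].
Qed.

Lemma kron1_repeat M c a : M *m const_mx 1 = a *: (const_mx 1 : 'cV[R]_n) ->
  kron1 p M *m repeat_cV c = a *: repeat_cV c.
Proof.
move=> Ma; apply: unstack_inj; rewrite unstack_kron1 unstackZ unstack_repeat.
by rewrite mulmxA Ma scalemxAl.
Qed.

Lemma kron1_null_span1 M u : null_span1 M -> kron1 p M *m u = 0 ->
  exists c, u = repeat_cV c.
Proof.
move=> nM /(congr1 unstack); rewrite unstack_kron1 unstack0 => Mu.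
have /choice[c cE] : forall j, exists a : R,
    col j (unstack u) = a *: const_mx 1.
  by move=> j; apply/nM; rewrite -col_mulmx Mu; apply/colP => i; rewrite !mxE.
exists (\col_j c j); apply: unstack_inj; rewrite unstack_repeat.
apply/matrixP => i j; have /colP/(_ i) := cE j.
by rewrite !mxE big_ord1 !mxE mulr1 mul1r.
Qed.

End Kron.

(** * Smooth strongly convex functions *)

Lemma dotp_grad (R : realType) m (f : 'cV[R]_m -> R) (x v : 'cV[R]_m) :
  dotp (grad f x) v = 'd f x v.
Proof.
rewrite [in RHS](matrix_sum_delta v) linear_sum dotpE; apply: eq_bigr => i _.
by rewrite linear_sum big_ord1 linearZ mxE mulrC.
Qed.

Lemma smoothP (R : realType) m l (f : 'cV[R]_m -> R) (x y : 'cV[R]_m) : 0 <= l ->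
  smooth l f ->
  dotp (grad f x - grad f y) (grad f x - grad f y)
    <= l ^+ 2 * dotp (x - y) (x - y).
Proof.
move=> l0 [_ /(_ x y)]; rewrite -!enorm_sqr -exprMn => h.
by rewrite ler_sqr ?nnegrE ?mulr_ge0 ?sqrtr_ge0.
Qed.

Lemma is_derive_line (R : realType) m (f : 'cV[R]_m -> R) (x v : 'cV[R]_m) (t : R) :
  (forall x, differentiable f x) ->
  is_derive t 1 (fun s : R => f (x + s *: v)) (dotp (grad f (x + t *: v)) v).
Proof.
move=> df; rewrite dotp_grad.
have dl : is_diff t (fun s : R => x + s *: v) (fun s : R => s *: v).
  have -> : (fun s : R => x + s *: v) = cst x + ( *:%R ^~ v) by [].
  apply: is_diff_eq (is_diffD (is_diff_cst x t) (is_diff_scalel t v)) _.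
  by apply/funext => s; rewrite fctE add0r.
have dff : is_diff (x + t *: v) f ('d f (x + t *: v)) by exact: DiffDef.
have dc := is_diff_comp dl dff.
have cd : differentiable (f \o (fun s : R => x + s *: v)) t by [].
apply: DeriveDef; first exact/derivable1_diffP.
by rewrite deriveE // diff_val /= scale1r.
Qed.

Lemma is_derive_add_quad (R : realType) (phi : R -> R) (t X Y k : R) :
  is_derive t 1 phi X ->
  is_derive t 1 (fun s => phi s + s * - Y + k / 2 * s ^+ 2) (X - Y + k * t).
Proof.
move=> dphi; apply: is_derive_eq.
have sE (a b : R) : a *: (b : R^o) = a * b by [].
by rewrite !sE; field.
Qed.

(** The mean value theorem replaces integration along the segment. Adding k t^2 / 2 with k = l |v|^2
    or k = - l |v|^2 gives the derivative a constant sign, since the Lipschitz bound at time c is l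
    |v|^2 c; this retains the sharp factor 1/2. *)
Lemma smooth_quad_approx (R : realType) m l (f : 'cV[R]_m -> R) (x v : 'cV[R]_m) :
  0 <= l -> smooth l f ->
  `|f (x + v) - f x - dotp (grad f x) v| <= l / 2 * dotp v v.
Proof.
move=> l0 sf.
have mvt (k : R) : exists2 c, 0 < c < 1 &
    f (x + v) - f x - dotp (grad f x) v + k / 2 =
    dotp (grad f (x + c *: v) - grad f x) v + k * c.
  pose F (t : R) := f (x + t *: v) + t * - dotp (grad f x) v + k / 2 * t ^+ 2.
  pose dF (t : R) := dotp (grad f (x + t *: v)) v - dotp (grad f x) v + k * t.
  have FdF (t : R) : is_derive t 1 F (dF t).
    exact: is_derive_add_quad (is_derive_line x v t sf.1).
  have [] := @MVT R F dF 0 1 ltr01 (fun t _ => FdF t).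
    by apply: derivable_within_continuous => t _.
  move=> c c01; rewrite subr0 mulr1 /F /dF => h.
  exists c; first by rewrite in_itv in c01.
  move: h; rewrite scale1r scale0r addr0 !dotp_lin => h.
  by rewrite -h; ring.
have bd c : 0 < c < 1 ->
    `|dotp (grad f (x + c *: v) - grad f x) v| <= l * dotp v v * c.
  move=> /andP[c0 _]; rewrite -ler_sqr ?nnegrE ?normr_ge0 //; last first.
    by rewrite !mulr_ge0 ?dotp_ge0 // ltW.
  rewrite real_normK ?num_real // (le_trans (dotp_cauchy_schwarz _ _)) //.
  have := smoothP (x + c *: v) x l0 sf.
  have -> : x + c *: v - x = c *: v by rewrite addrC addKr.
  move=> /(ler_wpM2r (dotp_ge0 v)) /le_trans; apply.
  by rewrite !dotp_lin le_eqVlt; apply/orP; left; apply/eqP; ring.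
rewrite ler_norml; apply/andP; split.
  have [c c01] := mvt (l * dotp v v).
  by have := bd c c01; rewrite ler_norml => /andP[]; lra.
have [c c01] := mvt (- (l * dotp v v)).
by have := bd c c01; rewrite ler_norml => /andP[]; lra.
Qed.

Lemma le_of_le_add_small (R : realFieldType) (a b c : R) :
  (forall t, 0 < t <= 1 -> a <= b + t * c) -> a <= b.
Proof.
move=> h; apply/ler_addgt0Pr => e e0.
have h0 : 0 < Num.min 1 (e / (`|c| + 1)).
  by rewrite lt_min ltr01 divr_gt0 // ltr_wpDl.
apply: (le_trans (h (Num.min 1 (e / (`|c| + 1))) _)).
  by rewrite h0 ge_min lexx.
rewrite lerD2l (le_trans (ler_wpM2l (ltW h0) (ler_norm c))) //.
apply: (@le_trans _ _ (e / (`|c| + 1) * `|c|)).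
  by rewrite ler_wpM2r // ge_min lexx orbT.
by rewrite mulrAC ler_pdivrMr ?ltr_wpDl // ler_wpM2l ?ltW // ltrDl.
Qed.

Section StronglyConvexSmooth.
Variables (R : realType) (m : nat) (mu l : R) (f : 'cV[R]_m -> R).
Implicit Types x y : 'cV[R]_m.
Hypotheses (mu0 : 0 <= mu) (l0 : 0 < l).
Hypotheses (scf : strongly_convex mu f) (smf : smooth l f).

Lemma strongly_convex_grad x y :
  f x + dotp (grad f x) (y - x) + mu / 2 * dotp (y - x) (y - x) <= f y.
Proof.
pose N := dotp (y - x) (y - x).
(* Strong convexity on the segment is divided by t before t tends to 0. The error has a part mu / 2
   from the factor 1 - t and a part l / 2 from the quadratic approximation at x. *)
apply: (@le_of_le_add_small _ _ _ ((mu + l) / 2 * N)) => t /andP[t0 t1].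
have t01 : 0 <= t <= 1 by rewrite ltW.
have := scf y x t01; rewrite enorm_sqr -/N.
have -> : t *: y + (1 - t) *: x = x + t *: (y - x).
  by rewrite scalerBl scale1r scalerBr addrCA.
have := smooth_quad_approx x (t *: (y - x)) (ltW l0) smf.
rewrite ler_norml => /andP[]; rewrite !dotpZr !dotpZl -/N => h _ h'.
rewrite -(ler_pM2l t0); nra.
Qed.

Lemma strongly_monotone_grad x y :
  mu * dotp (x - y) (x - y) <= dotp (x - y) (grad f x - grad f y).
Proof.
have := strongly_convex_grad x y; have := strongly_convex_grad y x.
move: (grad f x) (grad f y) => gx gy.
by rewrite !dotp_lin (dotpC x gx) (dotpC x gy) (dotpC y gx) (dotpC y gy) (dotpC y x); lra.
Qed.

(** The point z minimises the quadratic upper model at y of f - <grad f x, .>; there it is compared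
    with the lower bound that convexity gives from x. *)
Lemma convex_cocoercive_half x y :
  dotp (grad f y - grad f x) (grad f y - grad f x) / (2 * l)
    <= f y - f x - dotp (grad f x) (y - x).
Proof.
pose g := grad f y - grad f x; pose z := y - l^-1 *: g.
have := strongly_convex_grad x z.
have := smooth_quad_approx y (- (l^-1 *: g)) (ltW l0) smf.
rewrite ler_norml -/z => /andP[_] h1 h2.
have h3 : 0 <= mu / 2 * dotp (z - x) (z - x).
  by rewrite !mulr_ge0 ?invr_ge0 ?dotp_ge0.
move: h1 h2 h3; rewrite /z /g; move: (grad f x) (grad f y) => gx gy.
rewrite !dotp_lin (dotpC gy gx) => h1 h2 h3.
have lG : l * (l^-1 * (l^-1 * (dotp gy gy - dotp gx gy *+ 2 + dotp gx gx))) =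
    l^-1 * (dotp gy gy - dotp gx gy *+ 2 + dotp gx gx).
  by field; rewrite gt_eqF.
by rewrite invfM; lra.
Qed.

Lemma convex_cocoercive x y :
  dotp (grad f x - grad f y) (grad f x - grad f y)
    <= l * dotp (x - y) (grad f x - grad f y).
Proof.
have := convex_cocoercive_half x y; have := convex_cocoercive_half y x.
move: (grad f x) (grad f y) => gx gy.
rewrite -ler_pdivrMl // !dotp_lin (dotpC x gx) (dotpC x gy) (dotpC y gx) (dotpC y gy).
rewrite (dotpC gy gx) invfM.
lra.
Qed.

End StronglyConvexSmooth.

(** * Separable sums of smooth functions *)

Section SeparableSum.
Variables (R : realType) (n : nat) (d : 'I_n -> nat).
Variable f : forall i, 'cV[R]_(d i) -> R.
Arguments f : clear implicits.
Implicit Types (x v : 'cV[R]_(\sum_i d i)).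

Lemma continuous_submxcol i :
  continuous (fun x : 'cV[R]_(\sum_i d i) => submxcol x i).
Proof.
move=> x S /nbhs_ballP[e /= e0 eS].
apply/nbhs_ballP; exists e => //= y [_ xy]; apply: eS; split => // j k.
by apply: (le_lt_trans _ (xy (tagnat.Rank i j) k)); rewrite !mxE.
Qed.

Lemma is_diff_submxcol i x :
  is_diff x (fun x : 'cV[R]_(\sum_i d i) => submxcol x i)
    (fun x => submxcol x i).
Proof.
have lin : linear (fun x : 'cV[R]_(\sum_i d i) => submxcol x i).
  by move=> a u v /=; rewrite submxcolD submxcolZ.
pose sM := GRing.isLinear.Build _ _ _ _ _ lin.
pose sL : {linear 'cV[R]_(\sum_i d i) -> 'cV[R]_(d i)} :=
  HB.pack (fun x : 'cV[R]_(\sum_i d i) => submxcol x i) sM.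
apply: DiffDef.
  exact: (@linear_differentiable _ _ _ sL x (@continuous_submxcol i)).
exact: (@diff_lin _ _ _ sL x (@continuous_submxcol i)).
Qed.

Hypothesis df : forall i (x : 'cV[R]_(d i)), differentiable (f i) x.

Lemma is_diff_sumf x :
  is_diff x (sumf f)
    (fun v => \sum_i dotp (grad (f i) (submxcol x i)) (submxcol v i)).
Proof.
have -> : sumf f = \sum_i (f i \o (fun x => submxcol x i)).
  by apply/funext => y; rewrite fct_sumE.
have -> : (fun v => \sum_i dotp (grad (f i) (submxcol x i)) (submxcol v i)) =
    \sum_i ('d (f i) (submxcol x i) \o (fun v => submxcol v i)).
  apply/funext => v; rewrite fct_sumE; apply: eq_bigr => i _.
  by rewrite dotp_grad.
apply: (big_ind2 (fun g dg => is_diff x g dg)).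
- exact: is_diff_cst.
- by move=> g1 dg1 g2 dg2 d1 d2; exact: is_diffD.
- move=> i _; apply: is_diff_comp; first exact: is_diff_submxcol.
  exact: DiffDef.
Qed.

Lemma grad_sumf x i : submxcol (grad (sumf f) x) i = grad (f i) (submxcol x i).
Proof.
pose w := \mxcol_i grad (f i) (submxcol x i).
suff -> : grad (sumf f) x = w by rewrite mxcolK.
apply/colP => j; rewrite mxE (@diff_val _ _ _ _ _ _ _ (is_diff_sumf x)).
rewrite -dotp_delta dotp_blocks; apply: eq_bigr => k _.
by rewrite mxcolK.
Qed.

End SeparableSum.

Lemma smooth_sumf (R : realType) n (d : 'I_n -> nat) (l : R) (l_ : 'I_n -> R)
  (f : forall i, 'cV[R]_(d i) -> R) :
  0 <= l -> (forall i, 0 <= l_ i <= l) -> (forall i, smooth (l_ i) (f i)) ->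
  smooth l (sumf f).
Proof.
move=> l0 ll sf; have df i (x : 'cV[R]_(d i)) : differentiable (f i) x by case: (sf i).
split=> [x|x y]; first by have /@ex_diff := is_diff_sumf df x.
rewrite -ler_sqr ?nnegrE ?mulr_ge0 ?sqrtr_ge0 // exprMn !enorm_sqr.
rewrite !dotp_blocks mulr_sumr; apply: ler_sum => i _.
have /andP[li0 lil] := ll i.
have := smoothP (submxcol x i) (submxcol y i) li0 (sf i).
rewrite -(grad_sumf df x i) -(grad_sumf df y i) -!submxcolB => /le_trans; apply.
by rewrite ler_wpM2r ?dotp_ge0 // ler_sqr.
Qed.

Lemma strongly_convex_sumf (R : realType) n (d : 'I_n -> nat) (mu : R)
  (mu_ : 'I_n -> R) (f : forall i, 'cV[R]_(d i) -> R) :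
  (forall i, mu <= mu_ i) -> (forall i, strongly_convex (mu_ i) (f i)) ->
  strongly_convex mu (sumf f).
Proof.
move=> mum sf x y t /andP[t0 t1]; rewrite /sumf enorm_sqr dotp_blocks.
rewrite !mulr_sumr -big_split /= -sumrB; apply: ler_sum => i _.
rewrite submxcolD !submxcolZ submxcolB.
have t01 : 0 <= t <= 1 by rewrite t0.
apply: le_trans (sf i (submxcol x i) (submxcol y i) t t01) _.
rewrite enorm_sqr lerD2l lerN2 ler_wpM2r ?dotp_ge0 //.
by rewrite -!mulrA ler_wpM2r // !mulr_ge0 ?invr_ge0 ?subr_ge0.
Qed.

(** * Proximal maps and multipliers *)

(** Completing the square around x - a c shows that it is a minimiser and the only one, so [xget]
    never returns its default. *)
Lemma prox_linear (R : realType) m (a : R) (phi : 'cV[R]_m -> \bar R)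
  (c x : 'cV[R]_m) : 0 < a -> (forall y, phi y = (dotp c y)%:E) ->
  prox a phi x = x - a *: c.
Proof.
move=> a0 phiE; pose z := x - a *: c.
have E y : (phi y + ((2 * a)^-1 * enorm (y - x) ^+ 2)%:E)%E =
    ((2 * a)^-1 * dotp (y - z) (y - z) + (dotp c z + a / 2 * dotp c c))%:E.
  rewrite phiE enorm_sqr -EFinD /z; congr EFin.
  by rewrite !dotp_lin (dotpC y c) (dotpC x c) (dotpC y x); field; rewrite gt_eqF.
have a20 : 0 < (2 * a)^-1 by rewrite invr_gt0 mulr_gt0.
apply: xget_unique => [y|y /(_ z)] /=; rewrite !E lee_fin lerD2r subrr dotp0l mulr0.
  by rewrite mulr_ge0 ?dotp_ge0 // ltW.
rewrite pmulr_rle0 // => h; apply/eqP; rewrite -subr_eq0; apply/eqP.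
by apply: dotp_eq0; apply/eqP; rewrite eq_le h dotp_ge0.
Qed.

Lemma fenchel_indicator1 (R : realType) m (h : 'cV[R]_m -> \bar R)
  (b la : 'cV[R]_m) : (forall y, h y = if y == b then 0%E else +oo%E) ->
  fenchel h la = (dotp la b)%:E.
Proof.
move=> hE; apply/eqP; rewrite eq_le; apply/andP; split.
  apply: ge_ereal_sup => _ [y _ <-]; rewrite hE.
  by case: eqP => [->|_] /=; rewrite ?sube0 // leNye.
apply: ereal_sup_ubound; exists b => //=.
by rewrite hE eqxx sube0.
Qed.

Lemma hbold_indicator1 (R : realType) n p (h : 'cV[R]_p -> \bar R)
  (b : 'cV[R]_p) (la : 'cV[R]_(\sum_(i < n) p)) :
  (forall y, h y = if y == b then 0%E else +oo%E) ->
  hbold h la = (dotp (n%:R^-1 *: repeat_cV n b) la)%:E.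
Proof.
move=> hE; rewrite /hbold; under eq_bigr do rewrite (fenchel_indicator1 _ hE).
rewrite sumEFin -EFinM dotpZl dotp_blocks; congr (_ * _)%:E.
by apply: eq_bigr => i _; rewrite submxcol_repeat dotpC.
Qed.

Lemma row_free_tr_inj (R : realType) p q (M : 'M[R]_(p, q)) (u : 'cV[R]_p) :
  row_free M -> M^T *m u = 0 -> u = 0.
Proof.
move=> fM /(congr1 trmx); rewrite trmx_mul trmxK trmx0 => /eqP.
by rewrite mulmx_free_eq0 // => /eqP u0; rewrite -(trmxK u) u0 trmx0.
Qed.

(** The Gram matrix M M^T is invertible because M^T is injective. The solution serves to exhibit
    feasible points and to project a gradient onto the kernel of M. *)
Lemma row_free_solve (R : realType) p q (M : 'M[R]_(p, q)) (u : 'cV[R]_p) :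
  row_free M -> exists w : 'cV[R]_p, M *m (M^T *m w) = u.
Proof.
move=> fM; have uM : M *m M^T \in unitmx.
  rewrite -row_free_unit -kermx_eq0; apply/negPn/negP => /rowV0Pn[v vM v0].
  have h : M *m (M^T *m v^T) = 0.
    have := congr1 trmx (sub_kermxP vM).
    by rewrite !trmx_mul trmxK trmx0 -mulmxA.
  have {}h : M^T *m v^T = 0.
    by apply: dotp_eq0; rewrite -dotp_mulr h dotp0r.
  have v00 := row_free_tr_inj fM h.
  by move: v0; rewrite -(inj_eq trmx_inj) v00 trmx0 eqxx.
by exists (invmx (M *m M^T) *m u); rewrite mulmxA mulKVmx.
Qed.

(* The component of the gradient orthogonal to the range of M^T is an admissible
   direction, so it vanishes at a minimiser. *)
Lemma lagrange_multiplier (R : realType) p q (l : R) (F : 'cV[R]_q -> R)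
  (M : 'M[R]_(p, q)) (b : 'cV[R]_p) (xs : 'cV[R]_q) :
  0 <= l -> smooth l F -> row_free M -> M *m xs = b ->
  (forall x, M *m x = b -> F xs <= F x) ->
  exists la : 'cV[R]_p, grad F xs + M^T *m la = 0.
Proof.
move=> l0 sF fM Mxs minF.
have [w wE] := row_free_solve (- (M *m grad F xs)) fM.
exists w; pose v := grad F xs + M^T *m w.
have Mv : M *m v = 0 by rewrite mulmxDr wE subrr.
have gv : dotp (grad F xs) v = 0.
  (* Minimality along v and the quadratic upper bound give a quadratic in t with constant term 0
     that is never negative; its discriminant forces the linear coefficient to vanish. *)
  apply/eqP; suff : (dotp (grad F xs) v / 2) ^+ 2 <= 0 * (l / 2 * dotp v v).
    by rewrite mul0r real_exprn_even_le0 ?num_real //= mulf_eq0 invr_eq0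
      pnatr_eq0 orbF.
  apply: quad_nonneg_discr => t.
  have := smooth_quad_approx xs (t *: v) l0 sF.
  have := minF (xs + t *: v); rewrite mulmxDr Mxs -scalemxAr Mv scaler0 addr0.
  move=> /(_ erefl); rewrite ler_norml dotpZr dotpZl dotpZr => h /andP[_].
  lra.
apply: dotp_eq0; rewrite -/v /v dotpDl -/v gv add0r.
by rewrite dotp_mull trmxK Mv dotp0r.
Qed.

(** Full row rank provides a feasible point, so the minimum is finite and a minimiser cannot violate
    the constraint. *)
Lemma argmin_indicator1 (R : realType) p q (F : 'cV[R]_q -> R)
  (M : 'M[R]_(p, q)) (h : 'cV[R]_p -> \bar R) (b : 'cV[R]_p) (xs : 'cV[R]_q) :
  (forall y, h y = if y == b then 0%E else +oo%E) -> row_free M ->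
  argmin (fun x => (F x)%:E + h (M *m x))%E xs ->
  M *m xs = b /\ forall x, M *m x = b -> F xs <= F x.
Proof.
move=> hE fM mxs; have [w wE] := row_free_solve b fM.
have Mxs : M *m xs = b.
  apply/eqP; apply: contraT => nb; have := mxs (M^T *m w).
  by rewrite wE !hE (negPf nb) eqxx adde0 addey // leye_eq.
split=> // x Mx; have := mxs x.
by rewrite Mx Mxs !hE eqxx !adde0 lee_fin.
Qed.

(** * The Lyapunov function *)

Section Lyapunov.
Variables (R : realType) (q r : nat).
Variables (A : 'M[R]_(q, r)) (B C D : 'M[R]_q).
Implicit Types (v y la w z u : 'cV[R]_q) (x g : 'cV[R]_r).

(** The cross term is taken at x', the point that enters the dual step when theta = 0, so that it
    can cancel exactly. *)
Lemma primal_step_norm (alpha : R) x g la x' :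
  x' = x - alpha *: (g + A^T *m la) ->
  dotp x' x' = dotp (x - alpha *: g) (x - alpha *: g)
    - 2 * alpha * dotp la (A *m x')
    - alpha ^+ 2 * dotp (A^T *m la) (A^T *m la).
Proof.
move=> x'E; rewrite dotp_mulr x'E; move: (A^T *m la) => w.
rewrite !dotp_lin (dotpC w x) (dotpC w g) (dotpC g x); ring.
Qed.

(* Weighting by 1 - gamma B^2 makes the cross terms in B y cancel. *)
Lemma dual_step_norm (gamma : R) y w v' y' : B^T = B -> gamma != 0 ->
  v' = w - B *m y -> y' = y + gamma *: (B *m v') ->
  dotp v' v' - gamma * dotp (B *m v') (B *m v') + gamma^-1 * dotp y' y' =
  dotp w w - dotp (B *m y) (B *m y) + gamma^-1 * dotp y y.
Proof.
move=> sB g0 v'E y'E.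
have yv : dotp y (B *m v') = dotp (B *m y) w - dotp (B *m y) (B *m y).
  by rewrite dotp_mulr sB v'E !dotp_lin.
have vv : dotp v' v' =
    dotp w w - 2 * dotp (B *m y) w + dotp (B *m y) (B *m y).
  by rewrite v'E !dotp_lin (dotpC w (B *m y)); ring.
rewrite y'E; move: (B *m v') yv => b yv.
by rewrite !dotp_lin (dotpC b y) yv vv; field.
Qed.

(* Cauchy-Schwarz for the form C gives |C la|^2 <= s <la, C la>; what remains is
   |(1 - s) C la + s beta z|^2 >= 0. *)
Lemma dual_average_norm (s beta : R) la z : C^T = C ->
  (forall u, 0 <= dotp u (C *m u)) ->
  (forall u, dotp u (C *m u) <= s * dotp u u) -> 0 <= s < 1 ->
  dotp (la - C *m la + beta *: z) (la - C *m la + beta *: z) <=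
  dotp la la - dotp la (C *m la) + 2 * beta * dotp la z
  + beta ^+ 2 / (1 - s) * dotp z z.
Proof.
move=> sC C0 Cs /andP[s0 s1].
pose c := C *m la; pose t := dotp la c; pose k := dotp c c.
have t0 : 0 <= t by exact: C0.
have k0 : 0 <= k by exact: dotp_ge0.
have kst : k <= s * t.
  have := psd_cauchy_schwarz c la sC C0; rewrite -/c -/k -/t => kk.
  have [->|k1] := eqVneq k 0; first by rewrite mulr_ge0.
  rewrite -(ler_pM2l (_ : 0 < k)) ?lt_def ?k1 //.
  by rewrite -expr2 (le_trans kk) // mulrCA mulrA ler_wpM2r.
have p1 : 0 < 1 - s by rewrite subr_gt0.
have key : 0 <= t - k + 2 * beta * dotp c z
    + beta ^+ 2 * (s / (1 - s)) * dotp z z.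
  (* The square below is reached after multiplying by s (1 - s), which is useless at s = 0; there C
     la = 0 and the claim is trivial. *)
  have [s00|s00] := eqVneq s 0.
    have kE : k = 0.
      by apply/eqP; rewrite eq_le k0 andbT (le_trans kst) // s00 mul0r.
    have cE : c = 0 by exact: dotp_eq0.
    by rewrite kE cE dotp0l s00; nra.
  have sp : 0 < s by rewrite lt_def s00.
  rewrite -(pmulr_rge0 _ (mulr_gt0 sp p1)).
  have := dotp_ge0 ((1 - s) *: c + (s * beta) *: z).
  rewrite !dotp_lin -/k (dotpC z c) => h.
  have -> : s * (1 - s) * (t - k + 2 * beta * dotp c z
      + beta ^+ 2 * (s / (1 - s)) * dotp z z) =
    (1 - s) * (s * t - k) + ((1 - s) ^+ 2 * k
      + 2 * s * (1 - s) * beta * dotp c z + (s * beta) ^+ 2 * dotp z z).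
    by field; rewrite gt_eqF.
  have : 0 <= (1 - s) * (s * t - k) by rewrite mulr_ge0 ?(ltW p1) ?subr_ge0.
  by lra.
rewrite -/c -/t.
have -> : beta ^+ 2 / (1 - s) * dotp z z = beta ^+ 2 * dotp z z
    + beta ^+ 2 * (s / (1 - s)) * dotp z z.
  by field; rewrite gt_eqF.
rewrite !dotp_lin (dotpC z la) (dotpC z c) (dotpC c la) -/t -/k; lra.
Qed.

(** Cocoercivity and then strong monotonicity give the factor 1 - alpha mu (2 - alpha l). The stated
    product exceeds it by (alpha mu)^2 (1 - alpha l), and its first factor matches the weight of
    |x|^2 in [lyapunov]. *)
Lemma gradient_step_norm (alpha mu l : R) x g :
  0 < alpha -> alpha * l < 1 -> 0 <= mu <= l ->
  mu * dotp x x <= dotp x g -> dotp g g <= l * dotp x g ->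
  dotp (x - alpha *: g) (x - alpha *: g) <=
  (1 - alpha * mu) * (1 - alpha * mu * (1 - alpha * l)) * dotp x x.
Proof.
move=> a0 al1 /andP[mu0 mul] h1 h2.
rewrite !dotp_lin (dotpC g x).
have h3 : alpha ^+ 2 * dotp g g <= alpha ^+ 2 * (l * dotp x g).
  by rewrite ler_wpM2l // sqr_ge0.
have h4 : alpha * (2 - alpha * l) * (mu * dotp x x) <=
    alpha * (2 - alpha * l) * dotp x g.
  by rewrite ler_wpM2l // mulr_ge0 ?ltW //; lra.
have h5 : 0 <= (alpha * mu) ^+ 2 * (1 - alpha * l) * dotp x x.
  by rewrite mulr_ge0 ?dotp_ge0 // mulr_ge0 ?sqr_ge0 // subr_ge0 ltW.
lra.
Qed.

Variables (alpha beta gamma mu l s sA eta sB delta : R).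

Definition lyapunov x v y : R := (1 - alpha * mu) * dotp x x + alpha / beta *
  (dotp v v - gamma * dotp (B *m v) (B *m v) + gamma^-1 * dotp y y).

Hypotheses (alpha0 : 0 < alpha) (beta0 : 0 < beta) (gamma01 : 0 < gamma < 1).
Hypotheses (mul : 0 <= mu <= l) (al1 : alpha * l < 1) (s01 : 0 <= s < 1).
Hypotheses (tB : B^T = B) (tC : C^T = C) (eta0 : 0 <= eta).
Hypothesis C0 : forall u, 0 <= dotp u (C *m u).
Hypothesis Cs : forall u, dotp u (C *m u) <= s * dotp u u.
Hypothesis AsA : forall x, dotp (A *m x) (A *m x) <= sA * dotp x x.
Hypothesis beta_sA : beta * sA <= mu * (1 - s).
Hypothesis B1 : forall v, dotp (B *m v) (B *m v) <= dotp v v.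
Hypothesis DCD : forall v,
  dotp (D *m v) (D *m v) - dotp (D *m v) (C *m (D *m v)) <=
  dotp v v - dotp (B *m v) (B *m v).
Hypothesis Feta : forall v, eta * dotp v v <=
  dotp (A^T *m (D *m v)) (A^T *m (D *m v))
  + (1 - gamma) / (alpha * beta) * dotp (B *m v) (B *m v).
Hypothesis delta1 : 1 - alpha * mu * (1 - alpha * l) <= delta.
Hypothesis delta2 : 1 - alpha * beta * eta <= delta.
Hypothesis delta3 : 1 - gamma * sB <= delta.

(** Subtracting alpha beta <v, F v> from |v|^2 - gamma |B v|^2 removes at least alpha beta eta
    |v|^2, hence also at least that fraction of the smaller quantity |v|^2 - gamma |B v|^2. *)
Lemma dual_contraction v :
  alpha / beta * (dotp (D *m v) (D *m v) - dotp (D *m v) (C *m (D *m v)))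
  - alpha ^+ 2 * dotp (A^T *m (D *m v)) (A^T *m (D *m v)) <=
  alpha / beta * (delta * (dotp v v - gamma * dotp (B *m v) (B *m v))).
Proof.
case/andP: gamma01 => g0 g1.
have ab0 : 0 < alpha / beta by rewrite divr_gt0.
have := DCD v; have := Feta v; have := B1 v; have := dotp_ge0 (B *m v).
move: (dotp v v) (dotp (B *m v) (B *m v)) => V Bv.
move: (dotp (A^T *m (D *m v)) _) => T.
move: (dotp (D *m v) (D *m v) - _) => Q Bv0 BvV etaV QV.
have -> : alpha / beta * Q - alpha ^+ 2 * T =
  alpha / beta * (Q - alpha * beta * T) by field; rewrite gt_eqF.
rewrite ler_pM2l //.
have h1 : alpha * beta * (eta * V) <=
    alpha * beta * (T + (1 - gamma) / (alpha * beta) * Bv).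
  by rewrite ler_pM2l // mulr_gt0.
have h2 : alpha * beta * (T + (1 - gamma) / (alpha * beta) * Bv) =
    alpha * beta * T + (1 - gamma) * Bv.
  by field; rewrite !gt_eqF.
have h3 : 0 <= alpha * beta * eta * (gamma * Bv).
  by rewrite !mulr_ge0 // ltW.
have h4 : 0 <= V - gamma * Bv.
  by rewrite subr_ge0 (le_trans _ BvV) // ler_piMl // ltW.
have h5 : (1 - alpha * beta * eta) * (V - gamma * Bv) <=
    delta * (V - gamma * Bv) by rewrite ler_wpM2r.
lra.
Qed.

Lemma lyapunov_ge x v y : (1 - alpha * mu) * dotp x x <= lyapunov x v y.
Proof.
case/andP: gamma01 => g0 g1.
rewrite /lyapunov lerDl mulr_ge0 ?divr_ge0 ?(ltW alpha0) ?(ltW beta0) //.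
rewrite addr_ge0 ?mulr_ge0 ?dotp_ge0 ?invr_ge0 ?(ltW g0) //.
by rewrite subr_ge0 (le_trans _ (B1 v)) // ler_piMl ?dotp_ge0 // ltW.
Qed.

Lemma lyapunov_decrease x g v y la x' v' y' :
  mu * dotp x x <= dotp x g -> dotp g g <= l * dotp x g ->
  sB * dotp y y <= dotp (B *m y) (B *m y) ->
  la = D *m v ->
  x' = x - alpha *: (g + A^T *m la) ->
  v' = la - C *m la - B *m y + beta *: (A *m x') ->
  y' = y + gamma *: (B *m v') ->
  lyapunov x' v' y' <= delta * lyapunov x v y.
Proof.
move=> hx hg hy laE x'E v'E y'E.
case/andP: gamma01 => g0 g1; case/andP: s01 => s0 s1; case/andP: (mul) => mu0 _.
have ab0 : 0 < alpha / beta by rewrite divr_gt0.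
pose w := la - C *m la + beta *: (A *m x').
have v'w : v' = w - B *m y by rewrite v'E /w addrAC.
have S1 := primal_step_norm x'E.
have S2 := dual_step_norm tB (lt0r_neq0 g0) v'w y'E.
have S3 := dual_average_norm beta la (A *m x') tC C0 Cs s01.
have S4 : beta ^+ 2 / (1 - s) * dotp (A *m x') (A *m x') <=
    beta * mu * dotp x' x'.
  rewrite mulrAC ler_pdivrMr ?subr_gt0 //.
  apply: (@le_trans _ _ (beta ^+ 2 * (sA * dotp x' x'))).
    by rewrite ler_wpM2l ?sqr_ge0.
  have := ler_wpM2r (mulr_ge0 (ltW beta0) (dotp_ge0 x')) beta_sA.
  by rewrite expr2; lra.
have S5 := gradient_step_norm alpha0 al1 mul hx hg.
have S6 := dual_contraction v.
(* The loss |B y|^2 in [S2] is what contracts y: by [hy] it is at least the fraction gamma sB of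
   |y|^2 / gamma. *)
have S7 : gamma^-1 * dotp y y - dotp (B *m y) (B *m y) <=
    delta * (gamma^-1 * dotp y y).
  apply: (@le_trans _ _ ((1 - gamma * sB) * (gamma^-1 * dotp y y))).
    have -> : (1 - gamma * sB) * (gamma^-1 * dotp y y) =
      gamma^-1 * dotp y y - sB * dotp y y by field; rewrite gt_eqF.
    by rewrite lerD2l lerN2.
  by rewrite ler_wpM2r // mulr_ge0 ?dotp_ge0 // invr_ge0 ltW.
have S8 : (1 - alpha * mu) * (1 - alpha * mu * (1 - alpha * l)) * dotp x x <=
    (1 - alpha * mu) * delta * dotp x x.
  rewrite ler_wpM2r ?dotp_ge0 // ler_wpM2l // subr_ge0.
  apply: le_trans (ltW al1); rewrite ler_pM2l //.
  by case/andP: mul.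
rewrite /lyapunov S2.
have S3' : dotp w w <= dotp la la - dotp la (C *m la)
    + 2 * beta * dotp la (A *m x') + beta * mu * dotp x' x'.
  by apply: le_trans S3 _; rewrite lerD2l.
move: S3' => /(ler_wpM2l (ltW ab0)).
have -> : alpha / beta * (dotp la la - dotp la (C *m la)
    + 2 * beta * dotp la (A *m x') + beta * mu * dotp x' x') =
  alpha / beta * (dotp la la - dotp la (C *m la))
    + 2 * alpha * dotp la (A *m x') + alpha * mu * dotp x' x'.
  by field; rewrite gt_eqF.
move: S6 S7 => + /(ler_wpM2l (ltW ab0)); rewrite -laE.
move: (alpha / beta) => ab; move: S1 S5 S8.
move: (dotp w w) (dotp (x - _) _) (dotp x' x') (dotp la (A *m x')) => W X0 X' L.
move: (dotp (A^T *m la) _) (dotp la la - _) => T Q.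
lra.
Qed.

End Lyapunov.

(** * The NPGA iteration *)

Lemma inf_fin_image (R : realType) n (F : 'I_n -> R) : (0 < n)%N ->
  exists2 j, inf [set F i | i in setT] = F j & forall i, F j <= F i.
Proof.
move=> n0; have [j _ jF] := arg_minP F (erefl : xpredT (Ordinal n0)).
exists j => [|i]; last exact: jF.
apply/eqP; rewrite eq_le; apply/andP; split.
  by apply: ge_inf; [exists (F j) => _ [i _ <-]; exact: jF|exists j].
by apply: lb_le_inf; [exists (F j); exists j|move=> _ [i _ <-]; exact: jF].
Qed.

Lemma sup_fin_image (R : realType) n (F : 'I_n -> R) : (0 < n)%N ->
  exists2 j, sup [set F i | i in setT] = F j & forall i, F i <= F j.
Proof.
move=> n0; have [j _ jF] := arg_maxP F (erefl : xpredT (Ordinal n0)).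
exists j => [|i]; last exact: jF.
apply/eqP; rewrite eq_le; apply/andP; split.
  by apply: ge_sup; [exists (F j); exists j|move=> _ [i _ <-]; exact: jF].
by apply: ub_le_sup; [exists (F j) => _ [i _ <-]; exact: jF|exists j].
Qed.

(** * Stacked vectors whose blocks sum to zero *)

Section Balanced.
Variables (R : realType) (n p : nat).
Implicit Types (u v y : 'cV[R]_(\sum_(i < n) p)) (B : 'M[R]_n).

(** This is the orthogonal complement of the consensus vectors. For B symmetric with null space
    spanned by 1 it is the range of [kron1 p B], on which [sigma_min B] bounds B from below. *)
Definition balanced u :=
  forall j, dotp (const_mx 1 : 'cV[R]_n) (col j (unstack u)) = 0.

Lemma balanced0 : balanced 0.
Proof. by move=> j; rewrite unstack0 linear0 dotp0r. Qed.

Lemma balancedD a u v : balanced u -> balanced v -> balanced (u + a *: v).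
Proof.
move=> bu bv j; rewrite unstackD unstackZ linearD linearZ /= dotpDr dotpZr.
by rewrite bu bv mulr0 addr0.
Qed.

Lemma balanced_kron1 B u : B^T = B -> null_span1 B -> balanced (kron1 p B *m u).
Proof.
by move=> sB nB j; rewrite unstack_kron1 col_mulmx dotp_one_mul.
Qed.

Lemma balanced_blocks u : \sum_i submxcol u i = 0 -> balanced u.
Proof.
move=> u0 j; rewrite dotpE; have /colP/(_ j) := u0.
rewrite summxE mxE => {u0}u0; rewrite -[RHS]u0.
by apply: eq_bigr => i _; rewrite !mxE mul1r.
Qed.

Lemma balanced_surj B u : (0 < n)%N -> B^T = B -> null_span1 B -> balanced u ->
  exists2 y, balanced y & kron1 p B *m y = u.
Proof.
move=> n0 sB nB bu.
have /choice[w wE] : forall j, exists w, dotp (const_mx 1 : 'cV[R]_n) w = 0 /\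
    B *m w = col j (unstack u).
  by move=> j; have [w w0 Bw] := null_span1_surj sB nB n0 (bu j); exists w.
pose W : 'M[R]_(n, p) := \matrix_(i, j) w j i 0.
have colW j : col j W = w j by apply/colP => i; rewrite !mxE.
exists (stack W) => [j|]; first by rewrite stackK colW; case: (wE j).
apply: unstack_inj; rewrite unstack_kron1 stackK; apply/matrixP => i j.
have [_ /colP/(_ i)] := wE j; rewrite -{1}colW -col_mulmx !mxE.
by [].
Qed.

Lemma sigma_min_balanced B u : (1 < n)%N -> null_span1 B -> balanced u ->
  sigma_min B ^+ 2 * dotp u u <= dotp (kron1 p B *m u) (kron1 p B *m u).
Proof.
move=> n1 nB bu; have [_ h] := sigma_min_null_span1 nB n1.
rewrite !dotp_unstack mulr_sumr; apply: ler_sum => j _.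
by rewrite unstack_kron1 col_mulmx h.
Qed.

Lemma sigma_max_kron1 (C : 'M[R]_n) u :
  dotp u (kron1 p C *m u) <= sigma_max C * dotp u u.
Proof.
rewrite dotp_kron1 dotp_unstack mulr_sumr; apply: ler_sum => j _.
exact: sigma_max_quad.
Qed.

End Balanced.

(** * The affine form of the iteration and its fixed point *)

Section NPGA.
Variables (R : realType) (n p : nat) (d : 'I_n -> nat).
Variables (f : forall i, 'cV[R]_(d i) -> R) (g : forall i, 'cV[R]_(d i) -> \bar R).
Arguments f : clear implicits.
Arguments g : clear implicits.
Variables (h : 'cV[R]_p -> \bar R) (A : forall i, 'M[R]_(p, d i)).
Variables (B C D : 'M[R]_n) (b : 'cV[R]_p) (alpha beta gamma : R).
Hypotheses (alpha0 : 0 < alpha) (beta0 : 0 < beta).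
Hypothesis g0 : forall i x, g i x = 0%E.
Hypothesis hb : forall y, h y = if y == b then 0%E else +oo%E.
Local Notation BB := (kron1 p B).
Local Notation CC := (kron1 p C).
Local Notation DD := (kron1 p D).
Local Notation bbar := (n%:R^-1 *: repeat_cV n b).

Lemma sumg0 x : sumg g x = 0%E.
Proof. by rewrite /sumg big1. Qed.

Definition npga_xnext (s : npga_state R p d) : 'cV[R]_(\sum_i d i) :=
  npga_x s - alpha *: (grad (sumf f) (npga_x s) + (diagA A)^T *m npga_la s).

(** The state does not store v, yet the Lyapunov function depends on it; from state k this is the v
    of step k + 1. *)
Definition npga_v (s : npga_state R p d) : 'cV[R]_(\sum_(i < n) p) :=
  npga_la s - CC *m npga_la s - BB *m npga_y s
  + beta *: (diagA A *m npga_xnext s).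

Lemma npga_stepE s : npga_step f g h A B C D alpha beta gamma 0 s =
  NPGAState (npga_xnext s) (npga_y s + gamma *: (BB *m npga_v s))
    (DD *m npga_v s - beta *: bbar).
Proof.
case: s => x y la; rewrite /npga_step.
rewrite (@prox_linear _ _ _ _ bbar) //; last by move=> z; apply: hbold_indicator1.
rewrite (@prox_linear _ _ _ (sumg g) 0) //; last first.
  by move=> z; rewrite sumg0 dotp0l.
by rewrite scaler0 subr0 scale0r addr0.
Qed.

Lemma objective_indicator1 :
  objective f g h A = fun x => ((sumf f x)%:E + h (rowA A *m x))%E.
Proof. by apply/funext => x; rewrite /objective sumg0 adde0. Qed.

Lemma tr_diagA_repeat c : (diagA A)^T *m repeat_cV n c = (rowA A)^T *m c.
Proof.
by apply: submxcol_inj => i; rewrite tr_diagA_mul submxcol_repeat tr_rowA_mul.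
Qed.

(** The dual part [las] repeats the Lagrange multiplier in every block. Then C vanishes on it, D
    fixes [vs], and ys must solve B ys = beta (A xs - bbar); this is solvable because the blocks of
    A xs sum to b, as do the n copies of b / n. Choosing ys balanced keeps the error in y balanced
    too. *)
Lemma npga_fixpoint xs l : (0 < n)%N -> 0 <= l -> smooth l (sumf f) ->
  row_free (rowA A) -> argmin (objective f g h A) xs ->
  B^T = B -> null_span1 B -> C *m (const_mx 1 : 'cV[R]_n) = 0 ->
  D *m (const_mx 1 : 'cV[R]_n) = const_mx 1 ->
  exists las vs ys, [/\ balanced ys, BB *m vs = 0,
    grad (sumf f) xs + (diagA A)^T *m las = 0,
    vs = las - CC *m las - BB *m ys + beta *: (diagA A *m xs)
    & las = DD *m vs - beta *: bbar].
Proof.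
move=> n0 l0 sf fA; rewrite objective_indicator1 => mxs sB nB C1 D1.
have nR : n%:R != 0 :> R by rewrite pnatr_eq0 -lt0n.
have [Axs minF] := argmin_indicator1 hb fA mxs.
have [lb lbE] := lagrange_multiplier l0 sf fA Axs minF.
pose las := repeat_cV n lb; pose vs := las + beta *: bbar.
have vsE : vs = repeat_cV n (lb + (beta / n%:R) *: b).
  apply: submxcol_inj => i; rewrite /vs /las submxcolD !submxcolZ.
  by rewrite !submxcol_repeat scalerA.
have bu : balanced (beta *: (diagA A *m xs - bbar)).
  apply: balanced_blocks.
  transitivity (\sum_i beta *: (A i *m submxcol xs i - n%:R^-1 *: b)).
    apply: eq_bigr => i _.
    by rewrite submxcolZ submxcolB diagA_mul submxcolZ submxcol_repeat.
  rewrite -scaler_sumr sumrB -rowA_mul Axs sumr_const card_ord -scaler_nat.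
  by rewrite scalerA divff // scale1r subrr scaler0.
have [ys bys Bys] := balanced_surj n0 sB nB bu.
exists las, vs, ys; split=> //.
- by rewrite vsE (@kron1_repeat _ _ _ _ _ 0) ?scale0r // null_span1_mul.
- by rewrite tr_diagA_repeat.
- have Clas : CC *m las = 0.
    by rewrite (@kron1_repeat _ _ _ _ _ 0) ?scale0r // C1.
  by rewrite Clas subr0 Bys scalerBr opprB -addrA subrK.
- rewrite {1}vsE (@kron1_repeat _ _ _ _ _ 1) ?scale1r // -vsE /vs addrK.
  by [].
Qed.

End NPGA.

(** * Positive definiteness of F *)

Section DualMatrix.
Variables (R : realType) (n p : nat) (d : 'I_n -> nat).
Variables (A : forall i, 'M[R]_(p, d i)) (B D : 'M[R]_n) (c : R).
Hypotheses (sB : B^T = B) (sD : D^T = D).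

Let F := kron1 p D *m diagA A *m (diagA A)^T *m kron1 p D
         + c *: (kron1 p B *m kron1 p B).

Lemma dual_matrix_quad u : dotp u (F *m u) =
  dotp ((diagA A)^T *m (kron1 p D *m u)) ((diagA A)^T *m (kron1 p D *m u))
  + c * dotp (kron1 p B *m u) (kron1 p B *m u).
Proof.
rewrite mulmxDl dotpDr -scalemxAl dotpZr -!mulmxA; congr (_ + c * _).
  rewrite [LHS]dotp_mulr tr_kron1 sD.
  by rewrite [LHS]dotp_mulr.
by rewrite [LHS]dotp_mulr tr_kron1 sB.
Qed.

(** Where the B part vanishes, z repeats one block w. D fixes such a vector, so the A part becomes
    |A^T w|^2 with the row matrix A, and full row rank gives w = 0. *)
Lemma dual_matrix_pd : 0 < c -> null_span1 B ->
  D *m (const_mx 1 : 'cV[R]_n) = const_mx 1 -> row_free (rowA A) -> pdmx F.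
Proof.
move=> c0 nB D1 fA; split.
  rewrite /F linearD linearZ /= !trmx_mul trmxK !tr_kron1 sB sD !mulmxA.
  by [].
move=> z z0; rewrite dual_matrix_quad.
set a := dotp _ _; set e := dotp _ _.
have a0 : 0 <= a by exact: dotp_ge0.
have e0 : 0 <= e by exact: dotp_ge0.
rewrite lt_def addr_ge0 ?mulr_ge0 ?(ltW c0) // andbT paddr_eq0 ?mulr_ge0 ?(ltW c0) //.
apply/negP => /andP[/eqP /dotp_eq0 Az]; rewrite mulf_eq0 (gt_eqF c0) /=.
move=> /eqP /dotp_eq0 Bz; have [w wE] := kron1_null_span1 nB Bz.
move: Az; rewrite wE (@kron1_repeat _ _ _ _ _ 1) ?scale1r //.
rewrite tr_diagA_repeat => /(row_free_tr_inj fA) w0.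
move: z0; rewrite wE w0; apply/negP; rewrite negbK; apply/eqP.
by apply: submxcol_inj => i; rewrite submxcol_repeat submxcol0.
Qed.

End DualMatrix.

(** * Linear convergence *)

Lemma geometric_decay (R : realDomainType) (L : nat -> R) (q : R) : 0 <= q ->
  (forall k, L k.+1 <= q * L k) -> forall k, L k <= q ^+ k * L 0%N.
Proof.
move=> q0 Lq; elim=> [|k IH]; first by rewrite mul1r.
by rewrite (le_trans (Lq k)) // exprS -mulrA ler_wpM2l.
Qed.

Lemma geometric_bigO (R : realType) (u : nat -> R) (q c K : R) :
  0 < q -> 0 < c -> (forall k, 0 <= u k) ->
  (forall k, c * u k.+1 <= q ^+ k * K) ->
  u =O_\oo (fun k => q ^+ k).
Proof.
(* The extra q in the denominator pays for the index shift between u (k + 1) and q^k; the added 1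
   keeps the constant positive when K = 0. *)
move=> q0 c0 u0 uK; apply/eqO_exP; exists (`|K| / (c * q) + 1).
  by rewrite ltr_wpDl // divr_ge0 // ltW // mulr_gt0.
near=> k; have k0 : (0 < k)%N by near: k; exact: nbhs_infty_gt.
rewrite -(prednK k0) (ger0_norm (u0 _)).
rewrite (ger0_norm (exprn_ge0 _ (ltW q0))).
rewrite mulrDl mul1r ler_wpDr ?exprn_ge0 ?(ltW q0) // -(ler_pM2l c0).
apply: le_trans (uK k.-1) _; rewrite exprS.
have -> : c * (`|K| / (c * q) * (q * q ^+ k.-1)) = q ^+ k.-1 * `|K|.
  by field; rewrite !gt_eqF.
by rewrite ler_wpM2l ?ler_norm // exprn_ge0 // ltW.
Unshelve. all: by end_near. Qed.

Theorem theorem3 (R : realType) (n p : nat) (hn : (1 < n)%N) (hp : (0 < p)%N)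
  (d : 'I_n -> nat)
  (f : forall i, 'cV[R]_(d i) -> R) (g : forall i, 'cV[R]_(d i) -> \bar R)
  (h : 'cV[R]_p -> \bar R) (A : forall i, 'M[R]_(p, d i))
  (* network graph *)
  (e : rel 'I_n)
  (B C D : 'M[R]_n) (mu_ l_ : 'I_n -> R) (b : 'cV[R]_p)
  (* (1) *)
  (Hsaddle : exists (xs : 'cV[R]_(\sum_i d i)) (ls : 'cV[R]_p),
     saddle_point (lagrangian f g h A) xs ls)
  (* (2) *)
  (He_sym : symmetric e) (He_conn : forall i j, connect e i j)
  (* (3) *)
  (Hmul : forall i, 0 < mu_ i <= l_ i)
  (Hf_sc : forall i, strongly_convex (mu_ i) (f i))
  (Hf_sm : forall i, smooth (l_ i) (f i))
  (Hg : forall i, proper_convex_lsc (g i))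
  (Hh : proper_convex_lsc h)
  (* (4) *)
  (HB_sym : B^T = B) (HC_sym : C^T = C) (HD_sym : D^T = D)
  (HC_null : C = 0 \/ null_span1 C) (HB_null : null_span1 B)
  (HC_ge0 : mxle 0 C) (HC_lt1 : mxlt C 1%:M) (HB2 : mxle (B *m B) 1%:M)
  (HD : doubly_stochastic D)
  (* (5) *)
  (Hg0 : forall i x, g i x = 0%E) (HA : row_free (rowA A))
  (* (6) *)
  (Hhb : forall y, h y = if y == b then 0%E else +oo%E)
  (* (7) *)
  (HDCD : mxle (D *m (1%:M - C) *m D) (1%:M - B *m B))
  (* step sizes, initial points and the solution *)
  (alpha beta gamma : R)
  (Halpha0 : 0 < alpha) (Hbeta0 : 0 < beta) (Hgamma0 : 0 < gamma)
  (x0 : 'cV[R]_(\sum_i d i)) (la0 : 'cV[R]_(\sum_(i < n) p))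
  (xs : 'cV[R]_(\sum_i d i)) (Hxs : argmin (objective f g h A) xs) :
  let mu := inf [set mu_ i | i in setT] in
  let l := sup [set l_ i | i in setT] in
  alpha < 1 / l ->
  beta <= mu * (1 - sigma_max C) / sigma_max (diagA A) ^+ 2 ->
  gamma < 1 ->
  let F := kron1 p D *m diagA A *m (diagA A)^T *m kron1 p D
           + ((1 - gamma) / (alpha * beta)) *: (kron1 p B *m kron1 p B) in
  let delta := Num.max (1 - alpha * mu * (1 - alpha * l))
                 (Num.max (1 - alpha * beta * eta_min F)
                          (1 - gamma * sigma_min B ^+ 2)) in
  let x k := npga_x (npga f g h A B C D alpha beta gamma 0 x0 0 la0 k) in
  0 < delta < 1 /\
  (fun k => enorm (x k - xs) ^+ 2) =O_\oo (fun k => delta ^+ k).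
Proof.
move=> mu l al be ga1 F delta x.
have n0 : (0 < n)%N by exact: ltnW.
have [imu muE mumin] := inf_fin_image mu_ n0; rewrite -/mu in muE.
have [il lE lmax] := sup_fin_image l_ n0; rewrite -/l in lE.
have mu0 : 0 < mu by rewrite muE; case/andP: (Hmul imu).
have mul : mu <= l.
  by rewrite muE lE (le_trans _ (lmax imu)) //; case/andP: (Hmul imu).
have l0 : 0 < l by exact: lt_le_trans mul.
have al1 : alpha * l < 1 by rewrite -ltr_pdivlMr // in al *.
have smF : smooth l (sumf f).
  apply: (@smooth_sumf _ _ _ _ l_) => // [|i]; first exact: ltW.
  case/andP: (Hmul i) => mi li; rewrite (le_trans (ltW mi) li) /= lE.
  exact: lmax.
have scF : strongly_convex mu (sumf f).
  by apply: (@strongly_convex_sumf _ _ _ _ mu_) => // i; rewrite muE.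
have C1 : C *m (const_mx 1 : 'cV[R]_n) = 0.
  by case: HC_null => [->|nC]; rewrite ?mul0mx // null_span1_mul.
have D1 : D *m (const_mx 1 : 'cV[R]_n) = const_mx 1.
  apply/colP => i; rewrite !mxE; under eq_bigr do rewrite mxE mulr1.
  by case: HD.
have [las [vs [ys [bys Bvs gxs vsE lasE]]]] := npga_fixpoint beta Hg0 Hhb
  n0 (ltW l0) smF HA Hxs HB_sym HB_null C1 D1.
set s := sigma_max C in be.
have s0 : 0 <= s by exact: sigma_max_ge0.
have s1 : s < 1.
  (* If s were at least 1, the upper bound on the positive number beta would be nonpositive. *)
  rewrite ltNge; apply/negP => s1.
  have : mu * (1 - s) / sigma_max (diagA A) ^+ 2 <= 0.
    by rewrite mulr_le0_ge0 ?invr_ge0 ?sqr_ge0 // mulr_ge0_le0 ?(ltW mu0) ?subr_le0.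
  by move=> /(le_trans be); rewrite leNgt Hbeta0.
have beA : beta * sigma_max (diagA A) ^+ 2 <= mu * (1 - s).
  (* Division by 0 yields 0, so the denominator can be cleared only when it is nonzero. *)
  have [A0|A0] := eqVneq (sigma_max (diagA A) ^+ 2) 0.
    by rewrite A0 mulr0 mulr_ge0 ?(ltW mu0) // subr_ge0 ltW.
  by rewrite -ler_pdivlMr // lt_def A0 sqr_ge0.
have c0 : 0 < (1 - gamma) / (alpha * beta).
  by rewrite divr_gt0 ?subr_gt0 ?mulr_gt0.
have np : (0 < \sum_(i < n) p)%N by rewrite sum_nat_const card_ord muln_gt0 n0.
have [eta0 etaF] := eta_min_pd np (dual_matrix_pd HB_sym HD_sym c0 HB_null D1 HA).
rewrite -/F in eta0 etaF.
have [sB0 _] := sigma_min_null_span1 HB_null hn.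
have am1 : alpha * mu < 1 by apply: le_lt_trans al1; rewrite ler_pM2l.
have amp : 0 < alpha * mu by rewrite mulr_gt0.
have d1 : 1 - alpha * mu * (1 - alpha * l) <= delta by rewrite /delta le_max lexx.
have d2 : 1 - alpha * beta * eta_min F <= delta.
  by rewrite /delta !le_max lexx orbT.
have d3 : 1 - gamma * sigma_min B ^+ 2 <= delta.
  by rewrite /delta !le_max lexx !orbT.
have delta0 : 0 < delta.
  apply: lt_le_trans d1; rewrite subr_gt0 (le_lt_trans _ am1) //.
  by rewrite ger_pMr // gerBl mulr_ge0 // ltW.
have delta1 : delta < 1.
  rewrite /delta !gt_max !gtrBl !mulr_gt0 ?exprn_gt0 // ?subr_gt0 //.
split; first by rewrite delta0.
pose st k := npga f g h A B C D alpha beta gamma 0 x0 0 la0 k.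
pose v k := npga_v f A B C alpha beta (st k).
have stE k : st k.+1 = NPGAState (npga_xnext f A alpha (st k))
    (npga_y (st k) + gamma *: (kron1 p B *m v k))
    (kron1 p D *m v k - beta *: (n%:R^-1 *: repeat_cV n b)).
  by rewrite /st /npga iterS
    (npga_stepE f A B C D gamma Halpha0 Hbeta0 Hg0 Hhb).
have bst k : balanced (npga_y (st k)).
  elim: k => [|k IH]; first exact: balanced0.
  by rewrite stE; apply: balancedD => //; exact: balanced_kron1.
pose ex k := npga_x (st k) - xs; pose ey k := npga_y (st k) - ys.
pose ev k := v k - vs; pose ela k := npga_la (st k) - las.
pose eg k := grad (sumf f) (npga_x (st k)) - grad (sumf f) xs.
have exS k : ex k.+1 = ex k - alpha *: (eg k + (diagA A)^T *m ela k).
  rewrite /ex stE /= /npga_xnext /eg /ela mulmxBr.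
  have -> : (diagA A)^T *m las = - grad (sumf f) xs.
    by apply/eqP; rewrite -addr_eq0 addrC gxs.
  by rewrite opprK (addrC (_ *m _)) subrKA addrAC.
have evE k : ev k = ela k - kron1 p C *m ela k - kron1 p B *m ey k
    + beta *: (diagA A *m ex k.+1).
  rewrite /ev {1}vsE /v /npga_v /ela /ey /ex stE /=.
  move: (npga_la _) (npga_y _) (npga_xnext _ _ _ _) => la y x'.
  rewrite !mulmxBr scalerBr !opprD !opprK.
  by apply/colP => i; rewrite !mxE; ring.
have eyS k : ey k.+1 = ey k + gamma *: (kron1 p B *m ev k).
  by rewrite /ey stE /= /ev mulmxBr Bvs subr0 addrAC.
have elaS k : ela k.+1 = kron1 p D *m ev k.
  by rewrite /ela stE /= {1}lasE /ev mulmxBr opprB addrA subrK.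
(* Here [ev k] is the error of the v computed in step k + 1, hence the shift in the other arguments.
   The sequence starts after one step because the arbitrary [la0] need not satisfy la = D v. *)
pose L k := lyapunov (kron1 p B) alpha beta gamma mu (ex k.+1) (ev k) (ey k.+1).
have B1 u : dotp (kron1 p B *m u) (kron1 p B *m u) <= dotp u u.
  rewrite dotp_mull tr_kron1 HB_sym kron1_mul.
  by apply: le_trans (kron1_le u HB2) _; rewrite kron1_1.
have g01 : 0 < gamma < 1 by rewrite Hgamma0.
have mul0 : 0 <= mu <= l by rewrite (ltW mu0).
have s01 : 0 <= s < 1 by rewrite s0.
have C0 u : 0 <= dotp u (kron1 p C *m u).
  by apply: kron1_psd; move: HC_ge0; rewrite /mxle subr0.
have DCD u : dotp (kron1 p D *m u) (kron1 p D *m u)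
    - dotp (kron1 p D *m u) (kron1 p C *m (kron1 p D *m u)) <=
    dotp u u - dotp (kron1 p B *m u) (kron1 p B *m u).
  have := kron1_le u HDCD.
  rewrite -!kron1_mul !kron1_sub !kron1_1 -kron1_mul !dotp_lin.
  by rewrite (dotp_mulr (kron1 p D)) (dotp_mulr (kron1 p B)) !tr_kron1 HD_sym HB_sym
    !dotp_lin.
have Feta u : eta_min F * dotp u u <=
    dotp ((diagA A)^T *m (kron1 p D *m u)) ((diagA A)^T *m (kron1 p D *m u))
    + (1 - gamma) / (alpha * beta) * dotp (kron1 p B *m u) (kron1 p B *m u).
  by rewrite -(dual_matrix_quad _ _ HB_sym HD_sym).
have LS k : L k.+1 <= delta * L k.
  apply: (lyapunov_decrease Halpha0 Hbeta0 g01 mul0 al1 s01 _ _ (ltW eta0) C0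
    (sigma_max_kron1 C) (sigma_max_bound (diagA A)) beA B1 DCD Feta d1 d2 d3
    (g := eg k.+1) (la := ela k.+1)) => //.
  - by rewrite tr_kron1 HB_sym.
  - by rewrite tr_kron1 HC_sym.
  - exact: (strongly_monotone_grad l0 scF smF).
  - exact: (convex_cocoercive (ltW mu0) l0 scF smF).
  - apply: sigma_min_balanced => //; rewrite /ey -scaleN1r.
    exact: balancedD.
apply: (@geometric_bigO _ _ delta (1 - alpha * mu) (L 0%N)) => // [|k|k].
- by rewrite subr_gt0.
- exact: sqr_ge0.
- apply: le_trans (geometric_decay (ltW delta0) LS k).
  rewrite enorm_sqr.
  exact: (lyapunov_ge mu Halpha0 Hbeta0 g01 B1 (ex k.+1) (ev k) (ey k.+1)).
Qed.
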